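(* Let $d\ge 1$, $b\in(0,1)$ and $\kappa\ge 2d+1$. Let $\xi$ be the i.i.d. uniform $\kappa$-color scenery on $\mathbb{Z}^d$, let an independent simple symmetric branching random walk with branching probability $b$ start from one particle at the origin, and let $\chi$ be the resulting observed process (the coloring of the genealogical tree by the colors seen by the particles). Then there exists a measurable function $\Lambda:\Omega_3\to\Omega_2$, from the space $\Omega_3$ of all possible realizations of the observed process to the space $\Omega_2=\{0,1,\dots,\kappa-1\}^{\mathbb{Z}^d}$ of sceneries, such that $$P\big(\Lambda(\chi)\sim\xi\big)=1 .$$
   Context: Scenery: $\xi=(\xi_z)_{z\in\mathbb{Z}^d}$ is a family of i.i.d. random variables, uniform on $\{0,1,\dots,\kappa-1\}$, with $\kappa\ge4$ (automatic from $\kappa\ge 2d+1$ if $d\ge2$); we also write $\xi(z)=\xi_z$. Branching random walk (BRW): at time $0$ there is one particle, at the origin. At each time step, independently of everything else, each particle is replaced by two particles with probability $b$ and is left intact with probability $1-b$; then each resulting particle independently jumps to a uniformly chosen nearest neighbor in $\mathbb{Z}^d$. Let $G$ be the genealogical tree, $G_t$ the set of particles of generation (time) $t$, and $S(v)\in\mathbb{Z}^d$ the position of particle $v\in G$. (A particle left intact has exactly one child in $G$, a particle that splits has two.) The BRW and $\xi$ are independent; $P$ is the joint (product) law. Observations: $\chi:G\to\{0,\dots,\kappa-1\}$, $\chi(v)=\xi(S(v))$. One observes the tree $G$ together with its coloring $\chi$, but not the positions $S(v)$. $\Omega_3$ is the space of all such colored trees; $\Omega_2$ and $\Omega_3$ carry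 their natural (product) $\sigma$-algebras. Equivalence: $\xi\sim\xi'$ if there is an isometry $\varphi:\mathbb{Z}^d\to\mathbb{Z}^d$ with $\xi(\varphi x)=\xi'(x)$ for all $x\in\mathbb{Z}^d$. *)

(* Defs.v *)
From HB Require Import structures.
From mathcomp Require Import all_boot all_order all_algebra finmap.
From mathcomp Require Import all_classical all_reals all_analysis.

Set Implicit Arguments.
Unset Strict Implicit.
Unset Printing Implicit Defensive.

Import Order.TTheory GRing.Theory Num.Theory.

Local Open Scope classical_set_scope.
Local Open Scope ring_scope.

Definition site (d : nat) : Type := 'rV[int]_d.

Definition nearest_neighbors (d : nat) (x y : site d) : Prop :=
  \sum_(i < d) `|x ord0 i - y ord0 i| = 1.

Definition euclidean_dist (R : realType) (d : nat) (x y : site d) : R :=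
  Num.sqrt (\sum_(i < d) ((x ord0 i - y ord0 i)%:~R : R) ^+ 2).

(* An isometry of Z^d onto itself; bijectivity in fact follows from the
   preservation of the Euclidean distance. *)
Definition lattice_isometry (R : realType) (d : nat) (phi : site d -> site d)
    : Prop :=
  bijective phi /\
  forall x y, euclidean_dist R (phi x) (phi y) = euclidean_dist R x y.

Definition scenery (d kappa : nat) : Type := site d -> 'I_kappa.

Definition scenery_equiv (R : realType) (d kappa : nat)
    (xi xi' : scenery d kappa) : Prop :=
  exists phi : site d -> site d,
    lattice_isometry R phi /\ forall x, xi (phi x) = xi' x.

(* Ulam-Harris labels, read from the youngest generation backwards: [::] is the
   initial particle and [i :: v] is the child number i of v.  A particle that is
   left intact has the single child [false :: v]; a particle that splits has the
   two children [false :: v] and [true :: v].  The generation of v is [size v]. *)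
Definition particle : Type := seq bool.

(* A colored genealogical tree: [color_of v] is [Some c] when v belongs to the
   tree and has color c, and [None] when v does not belong to the tree. *)
Record colored_tree (kappa : nat) : Type := ColoredTree {
  color_of :> particle -> option 'I_kappa;
  root_in_tree : isSome (color_of [::]);
  first_child_in_tree : forall v,
    isSome (color_of (false :: v)) = isSome (color_of v);
  second_child_in_tree : forall v,
    isSome (color_of (true :: v)) -> isSome (color_of v) }.

(* The sigma-algebra generated by coordinates with values in a countable
   discrete space.  It is used as a bare set system because the library's
   measurableType requires a point, whereas 'I_kappa may be empty. *)
Definition coordinate_sigma (I S T : Type) (coord : I -> S -> T)
    : set (set S) :=
  <<s \bigcup_(i in [set: I])
        preimage_set_system setT (coord i) (@discrete_measurable T) >>.

Definition scenery_sigma (d kappa : nat) : set (set (scenery d kappa)) :=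
  coordinate_sigma (fun (z : site d) (xi : scenery d kappa) => xi z).

Definition colored_tree_sigma (kappa : nat) : set (set (colored_tree kappa)) :=
  coordinate_sigma (fun (v : particle) (chi : colored_tree kappa) => chi v).

Definition measurable_reconstruction (d kappa : nat)
    (Lambda : colored_tree kappa -> scenery d kappa) : Prop :=
  forall B, scenery_sigma B -> colored_tree_sigma (Lambda @^-1` B).

(* A realization of the branching walk is given by [split v] (does v split?)
   and [jump v] (the displacement by which v reaches its position from that of
   its parent).  The values at labels outside the tree and [jump [::]] are
   never used. *)
Fixpoint in_tree (split : particle -> bool) (v : particle) : bool :=
  if v is i :: u then in_tree split u && (i ==> split u) else true.

Fixpoint position (d : nat) (jump : particle -> site d) (v : particle)
    : site d :=
  if v is _ :: u then (position jump u + jump v)%R else (0 : 'rV[int]_d).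

Definition observed_color (d kappa : nat) (xi : scenery d kappa)
    (split : particle -> bool) (jump : particle -> site d) (v : particle)
    : option 'I_kappa :=
  if in_tree split v then Some (xi (position jump v)) else None.

Lemma observed_colorE (d kappa : nat) (xi : scenery d kappa)
    (split : particle -> bool) (jump : particle -> site d) (v : particle) :
  isSome (observed_color xi split jump v) = in_tree split v.
Proof. by rewrite /observed_color; case: ifP. Qed.

Lemma observed_root (d kappa : nat) (xi : scenery d kappa)
    (split : particle -> bool) (jump : particle -> site d) :
  isSome (observed_color xi split jump [::]).
Proof. by []. Qed.

Lemma observed_first_child (d kappa : nat) (xi : scenery d kappa)
    (split : particle -> bool) (jump : particle -> site d) (v : particle) :
  isSome (observed_color xi split jump (false :: v)) =
  isSome (observed_color xi split jump v).
Proof. by rewrite !observed_colorE /= andbT. Qed.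

Lemma observed_second_child (d kappa : nat) (xi : scenery d kappa)
    (split : particle -> bool) (jump : particle -> site d) (v : particle) :
  isSome (observed_color xi split jump (true :: v)) ->
  isSome (observed_color xi split jump v).
Proof. by rewrite !observed_colorE /= => /andP[]. Qed.

Definition observation (d kappa : nat) (xi : scenery d kappa)
    (split : particle -> bool) (jump : particle -> site d)
    : colored_tree kappa :=
  ColoredTree (observed_root xi split jump)
    (observed_first_child xi split jump) (@observed_second_child _ _ xi split jump).

Definition mutually_independent (disp : measure_display)
    (Omega : measurableType disp) (R : realType) (P : probability Omega R)
    (I : choiceType) (F : I -> set (set Omega)) : Prop :=
  forall (J : {fset I}) (E : I -> set Omega),
    (forall i, i \in J -> F i (E i)) ->
    P (\bigcap_(i in [set` J]) E i) = (\prod_(i <- J) P (E i))%E.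

Definition driving_events (Omega : Type) (d kappa : nat)
    (xi : Omega -> scenery d kappa) (split : Omega -> particle -> bool)
    (jump : Omega -> particle -> site d)
    (i : ('rV[int]_d + (seq bool + seq bool))%type) : set (set Omega) :=
  match i with
  | inl z => preimage_set_system setT (fun w => xi w z) (@discrete_measurable _)
  | inr (inl v) =>
      preimage_set_system setT (fun w => split w v) (@discrete_measurable _)
  | inr (inr v) =>
      preimage_set_system setT (fun w => jump w v) (@discrete_measurable _)
  end.

(* Joint independence of all the xi_z, split_v, jump_v expresses at once that
   the scenery is i.i.d., that particles branch and jump independently, and that
   the scenery is independent of the walk. *)
Record scenery_and_BRW (disp : measure_display) (Omega : measurableType disp)
    (R : realType) (P : probability Omega R) (d kappa : nat) (b : R)
    (xi : Omega -> scenery d kappa) (split : Omega -> particle -> bool)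
    (jump : Omega -> particle -> site d) : Prop := SceneryAndBRW {
  driving_measurable : forall i, driving_events xi split jump i `<=` measurable;
  driving_independent : mutually_independent P (driving_events xi split jump);
  scenery_uniform : forall (z : site d) (c : 'I_kappa),
    P [set w | xi w z = c] = ((kappa%:R : R)^-1)%:E;
  split_law : forall v : particle, P [set w | split w v = true] = b%:E;
  jump_uniform : forall (v : particle) (e : site d),
    nearest_neighbors (0 : 'rV[int]_d) e ->
    P [set w | jump w v = e] = (((2 * d)%:R : R)^-1)%:E }.

(* Main.v *)
Require Import Defs.
From HB Require Import structures.
From mathcomp Require Import all_boot all_order all_algebra finmap.
From mathcomp Require Import all_classical all_reals all_analysis.
From mathcomp Require Import zify ring lra.

Set Implicit Arguments.
Unset Strict Implicit.
Unset Printing Implicit Defensive.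

Import Order.TTheory GRing.Theory Num.Theory.

Local Open Scope classical_set_scope.
Local Open Scope ring_scope.

(* Since [2 d < kappa], a union bound over pairs of paths shows that, inside a
   ball of radius exponential in [n], the color word of a straight path of
   length [2 n] can only be read along a path that passes through the midpoint of
   the straight one at the right time.  Call a site visible at time [t] if all
   words of length [O(n)] leaving it, three at a time (one read upwards along the
   ancestors of a particle, two downwards along its descendants), have been
   observed by time [t].  The branching walk makes all sites of the ball of radius
   [K^k] visible at time [K^(k+1)]: its hitting probabilities satisfy a branching
   recursion whose linear part grows exponentially on a tent-shaped function.

   A pair of words labels a site unambiguously if any two words that complete it
   to an observed triple are also observed back to back: otherwise two straight
   words leaving two different sites in opposite directions would be read by one
   particle, although their midpoints are too far apart for that.  Equality and
   adjacency of labelled sites are tested in the same way.  Hence a coloring of a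
   ball that comes with a dictionary of labels passing these tests is a copy of a
   part of the scenery under an injective adjacency-preserving map, which is an
   isometry by an argument on squares.  The scenery itself passes the tests at all
   large scales, a compactness argument selects measurably some scenery that does,
   and consecutive scales force all the isometries found to coincide. *)

(** * Paths in the lattice and straight color words *)

(** Two opposite demands fix the scales: words must be long enough to tell apart all sites that the
    walk can reach, yet short enough that every one of them gets produced. Agreement over [m] steps
    costs [kappa ^ -m] against [(2 d) ^ m] paths, so [m = C k] with [C] large pays for the pairs of
    sites, about [K ^ (2 d k)] of them. The walk misses a given triple of words with probability
    exponentially small in [K ^ k], while the number of triples is exponential in [k] only. Hitting
    times are linear in the radius, so consecutive scales may differ by a constant factor.

    Positions are never observed, so soundness must hold for every dictionary that passes the tests
    and not just for the intended one; hence words that complete a label are compared with each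
    other, there being no reference to compare them with. Dictionaries and words are finite objects,
    so passing the tests is a countable combination of conditions on the tree. Branching enters
    twice: it lets one particle show two lines of descendants, and it outweighs the factor that the
    hitting recursion loses by averaging. *)

Section Lattice.
Variable d : nat.
Implicit Types (x y z u : 'rV[int]_d).

Definition dir := ('I_d * bool)%type.
Implicit Types (e : dir) (p q : seq dir).

Definition vec e : 'rV[int]_d := \row_j (if j == e.1 then (if e.2 then 1 else -1) else 0).
Definition opp e : dir := (e.1, ~~ e.2).
Definition co e x : int := if e.2 then x ord0 e.1 else - x ord0 e.1.
Definition nrm x : nat := (\sum_(i < d) `|x ord0 i|)%N.

Lemma oppK : involutive opp.
Proof. by case=> i s; rewrite /opp /= negbK. Qed.

Lemma vec_opp e : vec (opp e) = - vec e.
Proof. by apply/rowP => j; rewrite !mxE /=; case: eqP; case: e.2 => //=; rewrite ?opprK ?oppr0. Qed.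

Lemma co_opp e x : co (opp e) x = - co e x.
Proof. by rewrite /co /=; case: e.2 => //=; rewrite opprK. Qed.

Lemma coD e x y : co e (x + y) = co e x + co e y.
Proof. by rewrite /co mxE; case: e.2; rewrite ?opprD. Qed.

Lemma coN e x : co e (- x) = - co e x.
Proof. by rewrite /co mxE; case: e.2. Qed.

Lemma co0 e : co e 0 = 0.
Proof. by rewrite /co mxE; case: e.2; rewrite ?oppr0. Qed.

Lemma coMn e x n : co e (x *+ n) = co e x *+ n.
Proof. by elim: n => [|n IH]; rewrite ?mulr0n ?co0 // !mulrS coD IH. Qed.

Lemma co_vec e : co e (vec e) = 1.
Proof. by rewrite /co mxE eqxx; case: e.2; rewrite ?opprK. Qed.

Lemma co_vec_le e f : co e (vec f) <= 1.
Proof. by rewrite /co mxE; case: eqP; case: e.2; case: f.2. Qed.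

Lemma co_vec1 e f : co e (vec f) = 1 -> f = e.
Proof.
case: e f => [i s] [j t]; rewrite /co mxE /=.
by case: eqP => [->|_]; case: s; case: t.
Qed.

Lemma nrm0 : nrm 0 = 0%N.
Proof. by rewrite /nrm big1 // => i _; rewrite mxE. Qed.

Lemma nrm_eq0 x : nrm x = 0%N -> x = 0.
Proof.
move/eqP; rewrite /nrm sum_nat_eq0 => /forallP h.
by apply/rowP => i; rewrite mxE; have := h i; rewrite implyTb absz_eq0 => /eqP.
Qed.

Lemma nrmN x : nrm (- x) = nrm x.
Proof. by apply: eq_bigr => i _; rewrite mxE abszN. Qed.

Lemma nrmD x y : (nrm (x + y)%R <= nrm x + nrm y)%N.
Proof. by rewrite /nrm -big_split leq_sum // => i _; rewrite mxE /=; lia. Qed.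

Lemma le_nrm x i : (`|x ord0 i| <= nrm x)%N.
Proof. by rewrite /nrm (bigD1 i) //= leq_addr. Qed.

(** The condition on [e] can always be met by [e] or [opp e], so this identity serves every
    separation argument: it turns closeness to shifted points into a bound on the unshifted one. *)
Lemma nrm_push e u m : 0 <= co e u -> nrm (u + vec e *+ m) = (nrm u + m)%N.
Proof.
move=> h; rewrite /nrm (bigD1 e.1) //= [in RHS](bigD1 e.1) //=.
rewrite (eq_bigr (fun i => `|u ord0 i|%N)); last first.
  by move=> j /negPf ne; rewrite mxE mulmxnE mxE ne mul0rn addr0.
rewrite addnAC; congr (_ + _)%N.
rewrite mxE mulmxnE mxE eqxx.
by move: h; rewrite /co; case: e.2; rewrite ?mulNrn natz; move: (u _ _) => a; lia.
Qed.

Lemma nrm_vec e : nrm (vec e) = 1%N.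
Proof. by rewrite -[vec e]add0r -[vec e]mulr1n nrm_push ?co0 // nrm0. Qed.

Lemma nrm1_vec x : nrm x = 1%N -> exists e, x = vec e.
Proof.
move=> h.
have [i xi] : exists i, x ord0 i != 0.
  apply: contrapT => /forallNP h0; move: h; rewrite /nrm big1 // => i _.
  by have /negP := h0 i; rewrite negbK => /eqP ->.
exists (i, 0 <= x ord0 i).
move: h; rewrite /nrm (bigD1 i) //= => h.
have rest j : j != i -> x ord0 j = 0.
  move=> ji; apply/eqP; rewrite -absz_eq0.
  have : (\sum_(k < d | k != i) `|x ord0 k| = 0)%N by move: xi h;
      move: (x _ _) (\sum_(_ < _ | _) _)%N => a s; lia.
  by move/eqP; rewrite sum_nat_eq0 => /forallP /(_ j); rewrite ji.
apply/rowP => j; rewrite !mxE /=; case: eqP => [->|/eqP/rest //].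
by move: xi h; move: (x _ _) (\sum_(_ < _ | _) _)%N => a s; case: leP; lia.
Qed.

(** One of the two shifts moves [u] away from the origin and adds exactly [m] to its norm. Applied
    to the midpoints of the two words of a label, both within [m] of the site that reads them. *)
Lemma sandwich e u m :
  (nrm (u + vec e *+ m)%R <= m)%N -> (nrm (u - vec e *+ m)%R <= m)%N -> u = 0.
Proof.
have [h|h] := leP 0 (co e u).
  by rewrite nrm_push // => h1 _; apply: nrm_eq0; lia.
move=> _; rewrite -mulNrn -vec_opp nrm_push; last by rewrite co_opp oppr_ge0 ltW.
by move=> h1; apply: nrm_eq0; lia.
Qed.

(** Excludes all nondegenerate 4-cycles but parallelograms: the components of the equation along [b]
    and along [a], where each step contributes -1, 0 or 1, leave no other case. *)
Lemma common_neighbor (a b c f : dir) :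
  vec a + vec c = vec b + vec f -> a <> b -> vec a + vec c <> 0 ->
  c = b /\ b <> opp a.
Proof.
move=> E ab ac.
have h1 := congr1 (co b) E; rewrite !coD co_vec in h1.
suff cb : c = b by split=> // ba; apply: ac; rewrite cb ba vec_opp subrr.
have h2 := congr1 (co a) E; rewrite !coD co_vec in h2.
have hac : co a (vec c) <> -1.
  move=> h; apply: ac; rewrite -[c]oppK vec_opp; apply/eqP; rewrite subr_eq0; apply/eqP.
  by congr vec; apply/esym/co_vec1; rewrite vec_opp coN h opprK.
have cov (g k : dir) : [\/ co g (vec k) = 1, co g (vec k) = 0 | co g (vec k) = -1].
  rewrite /co mxE; case: eqP => _; case: g.2; case: k.2 => /=;
   by [constructor 1|constructor 2|constructor 3].
have ab' : co a (vec b) <> 1 by move/co_vec1 => ?; apply: ab.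
have af : co a (vec f) = 1.
  move: (cov a f) (cov a b) (cov a c) ab' hac h2.
  move: (co a (vec f)) (co a (vec b)) (co a (vec c)) => s t r.
  by case=> ?; case=> ?; case=> ?; lia.
have := co_vec1 af => fa; subst f.
have ba : co b (vec a) = co a (vec b).
  move: (a) (b) => [i s] [j t]; rewrite /co !mxE /= eq_sym.
  by case: eqP; case: s; case: t.
apply: co_vec1; move: h1; rewrite ba; move: (cov a b) ab'.
move: (co a (vec b)) (co b (vec c)) => s t.
by case=> ?; lia.
Qed.

Fixpoint pos x p : 'rV[int]_d := if p is e :: p' then pos (x + vec e) p' else x.

Lemma pos_cat x p q : pos x (p ++ q) = pos (pos x p) q.
Proof. by elim: p x => /=. Qed.

Lemma pos_rcons x p e : pos x (rcons p e) = pos x p + vec e.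
Proof. by rewrite -cats1 pos_cat. Qed.

Lemma pos_nseq x n e : pos x (nseq n e) = x + vec e *+ n.
Proof. by elim: n x => [|n IH] x; rewrite ?mulr0n ?addr0 //= IH mulrS addrA. Qed.

Lemma nrm_pos x y p : (nrm (pos x p - y)%R <= nrm (x - y)%R + size p)%N.
Proof.
elim: p x => [|e p IH] x /=; first by rewrite addn0.
apply: leq_trans (IH _) _; rewrite -addSnnS leq_add2r.
by rewrite addrAC (leq_trans (nrmD _ _)) // nrm_vec addn1.
Qed.

Lemma nrm_pos0 x p : (nrm (pos x p) <= nrm x + size p)%N.
Proof. by have := nrm_pos x 0 p; rewrite !subr0. Qed.

Lemma nrm_posB x p : (nrm (pos x p - x)%R <= size p)%N.
Proof. by have := nrm_pos x x p; rewrite subrr nrm0. Qed.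

Definition rpath p := rev (map opp p).

Lemma size_rpath p : size (rpath p) = size p.
Proof. by rewrite size_rev size_map. Qed.

Lemma rpath_cons e p : rpath (e :: p) = rcons (rpath p) (opp e).
Proof. by rewrite /rpath /= rev_cons. Qed.

Lemma rpath_nseq n e : rpath (nseq n e) = nseq n (opp e).
Proof. by rewrite /rpath map_nseq rev_nseq. Qed.

Lemma pos_rpath x p : pos (pos x p) (rpath p) = x.
Proof. by elim: p x => //= e p IH x; rewrite rpath_cons pos_rcons IH vec_opp addrK. Qed.

(** * Color words read along paths *)

Section Trace.
Variables (C : Type) (xi : 'rV[int]_d -> C).

Fixpoint trace x p : seq C :=
  xi x :: if p is e :: p' then trace (x + vec e) p' else [::].

Lemma size_trace x p : size (trace x p) = (size p).+1.
Proof. by elim: p x => //= e p IH x; rewrite IH. Qed.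

Lemma trace_rcons x p e : trace x (rcons p e) = rcons (trace x p) (xi (pos x p + vec e)).
Proof. by elim: p x => //= f p IH x; rewrite IH. Qed.

Lemma rev_trace x p : rev (trace x p) = trace (pos x p) (rpath p).
Proof.
by elim: p x => //= e p IH x; rewrite rev_cons IH rpath_cons trace_rcons pos_rpath vec_opp addrK.
Qed.

Lemma take_trace x p n : take n.+1 (trace x p) = trace x (take n p).
Proof. by elim: p x n => [|e p IH] x [|n] //=; rewrite ?take0 // IH. Qed.

Lemma drop_trace x p n : (n <= size p)%N ->
  drop n (trace x p) = trace (pos x (take n p)) (drop n p).
Proof. by elim: p x n => [|e p IH] x [|n] //= h; rewrite IH. Qed.

Lemma nth_trace c x p n : (n <= size p)%N ->
  nth c (trace x p) n = xi (pos x (take n p)).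
Proof. by elim: p x n => [|e p IH] x [|n] //= h; rewrite IH. Qed.

(** Only the middle of the word is pinned down: near its ends a path can deviate and still read the
    right colors by chance, whereas a deviation at half time persists through one of the two
    halves. *)
Definition localizes (T m : nat) := forall y z e p,
  (nrm y <= T)%N -> (nrm z <= T)%N -> size p = (m + m)%N ->
  trace z p = trace y (nseq (m + m) e) ->
  pos z (take m p) = y + vec e *+ m.

(* A path that does not run ahead of the straight path from [y] and has not met
   it yet stays behind it forever; running ahead is the time reversal of this. *)
Lemma localizesI (T m : nat) :
  (forall y z e p, (nrm y <= T + m)%N -> (nrm z <= T + m)%N -> size p = m ->
     y <> z -> co e z <= co e y -> trace z p <> trace y (nseq m e)) ->
  localizes T m.
Proof.
move=> H y z e p yT zT sp E.
have sm : size (take m p) = m by rewrite size_takel // sp leq_addr.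
(* The halves are compared from the midpoints, which may lie [m] outside the ball; hence the radius
   [T + m] in [H]. *)
have ny : (nrm (y + vec e *+ m) <= T + m)%N.
  by rewrite -pos_nseq (leq_trans (nrm_pos0 _ _)) // size_nseq leq_add2r.
have nz : (nrm (pos z (take m p)) <= T + m)%N.
  by rewrite (leq_trans (nrm_pos0 _ _)) // sm leq_add2r.
apply: contrapT => ne.
have tk : take m (nseq (m + m) e) = nseq m e by rewrite take_nseq ?leq_addr.
have dr : drop m (nseq (m + m) e) = nseq m e by rewrite drop_nseq addnK.
have [h|h] := leP (co e (pos z (take m p))) (co e (y + vec e *+ m)).
  apply: (H _ _ e (drop m p) ny nz) => //.
  - by rewrite size_drop sp addnK.
  - by move=> /esym.
  rewrite -drop_trace ?sp ?leq_addr // E drop_trace ?size_nseq ?leq_addr //.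
  by rewrite tk dr pos_nseq.
apply: (H _ _ (opp e) (rpath (take m p)) ny nz) => //.
- by rewrite size_rpath.
- by move=> /esym.
- by rewrite !co_opp lerN2 ltW.
rewrite -rev_trace -take_trace E take_trace tk -rpath_nseq -pos_nseq.
exact: rev_trace.
Qed.

End Trace.

Lemma co_pos_le e z p : co e (pos z p) <= co e z + (size p)%:Z.
Proof.
elim: p z => [|f p IH] z /=; first by rewrite addr0.
by apply: le_trans (IH _) _; rewrite coD; have := co_vec_le e f; lia.
Qed.

Lemma pos_behind e y z p : y <> z -> co e z <= co e y ->
  pos z p <> y + vec e *+ size p.
Proof.
elim: p y z => [|f p IH] y z yz h /=; first by rewrite addr0 => /esym.
rewrite mulrS addrA; have [->|/eqP fe] := eqVneq f e.
  by apply: IH; [move=> /addIr|rewrite !coD lerD2r].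
have lt : co e (z + vec f) < co e (y + vec e).
  rewrite !coD co_vec; have ne : co e (vec f) <> 1 by move/co_vec1.
  by move: h (co_vec_le e f) ne; move: (co _ _) (co _ _) (co _ _) => r s t; lia.
by apply: IH (ltW lt) => E; move: lt; rewrite E ltxx.
Qed.

(* Each site of the straight path is fresh: the other path cannot have visited
   it at the same or at an earlier time. *)
Lemma straight_fresh e y z p (i : nat) : y <> z -> co e z <= co e y ->
  (i <= size p)%N -> pos z (take i p) <> y + vec e *+ size p.
Proof.
move=> yz h; rewrite leq_eqVlt => /orP[/eqP ->|ilt].
  by rewrite take_size; exact: pos_behind.
move=> E; have := co_pos_le e z (take i p).
rewrite size_takel; last exact: ltnW.
rewrite E coD coMn co_vec -[1 *+ _]/((size p)%:R) natz.
by move: h ilt; move: (co e z) (co e y) (size p) => a b n; lia.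
Qed.

End Lattice.

(** * Lattice isometries *)

Section Rigidity.
Variable d : nat.
Implicit Types (x y z u : 'rV[int]_d) (e g : dir d).

Lemma vec_inj : injective (@vec d).
Proof. by move=> e g E; apply: co_vec1; rewrite E co_vec. Qed.

Lemma opp_neq e : opp e != e.
Proof. by case: e => i s; rewrite xpair_eqE /= eqxx; case: s. Qed.

Lemma nrm_ind (P : 'rV[int]_d -> Prop) : P 0 ->
  (forall y e, nrm (y + vec e) = (nrm y).+1 -> P y -> P (y + vec e)) ->
  forall x, P x.
Proof.
move=> P0 PS x; have [n] := ubnP (nrm x); elim: n x => // n IH x.
have [->//|x0] := eqVneq x 0.
have [i xi] : exists i, x ord0 i != 0.
  apply: contrapT => /forallNP h; move/eqP: x0; apply; apply/rowP => i.
  by have /negP := h i; rewrite negbK mxE => /eqP.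
pose e : dir d := (i, 0 < x ord0 i).
have ce : 0 <= co e (x - vec e).
  rewrite coD coN co_vec /co /e /=.
  by move: xi; move: (x ord0 i) => a; case: ltP; lia.
have nx : nrm x = (nrm (x - vec e)).+1.
  by have := nrm_push 1 ce; rewrite mulr1n subrK addn1.
rewrite ltnS => h; rewrite -(subrK (vec e) x); apply: PS; first by rewrite subrK.
by apply: IH; rewrite -nx.
Qed.

Lemma dot_vec e g :
  \sum_k vec e ord0 k * vec g ord0 k = if e.1 == g.1 then (if e.2 == g.2 then 1 else -1) else 0
      :> int.
Proof.
rewrite (bigD1 e.1) //= big1 => [|k /negPf ke]; last by rewrite !mxE ke mul0r.
by rewrite !mxE eqxx addr0; case: eqP => _; case: e.2; case: g.2.
Qed.

(* Two perpendicular steps from a site close up to a square, whose image is a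
   nondegenerate 4-cycle, i.e. again a parallelogram; hence opposite directions
   are mapped to opposite directions and directions are transported unchanged. *)
Lemma rigidity (f : 'rV[int]_d -> 'rV[int]_d) (r : nat) :
  (forall x y, (nrm x <= r.+2)%N -> (nrm y <= r.+2)%N ->
     nrm (x - y) = 1%N -> nrm (f x - f y) = 1%N) ->
  (forall x y, (nrm x <= r.+2)%N -> (nrm y <= r.+2)%N -> f x = f y -> x = y) ->
  exists2 M : 'M[int]_d, M *m M^T = 1%:M &
    forall x, (nrm x <= r.+1)%N -> f x = f 0 + x *m M.
Proof.
move=> adj inj.
(* The direction of the image of the step [e] from [x]; by [fs] the default is irrelevant within
   radius [r.+1]. *)
pose s x e := odflt e [pick g | f (x + vec e) == f x + vec g].
have step_le n x e : (nrm x <= n)%N -> (nrm (x + vec e) <= n.+1)%N.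
  by move=> h; rewrite (leq_trans (nrmD _ _)) // nrm_vec addn1 ltnS.
have fs x e : (nrm x <= r.+1)%N -> f (x + vec e) = f x + vec (s x e).
  move=> h; rewrite /s; case: pickP => [g /eqP //|none].
  have [g E] : exists g, f (x + vec e) - f x = vec g.
    apply: nrm1_vec; apply: adj; [exact: step_le|exact: ltnW|].
    by rewrite addrC addKr nrm_vec.
  by have := none g; rewrite -E [f x + _]addrC subrK eqxx.
have sinj x : (nrm x <= r.+1)%N -> injective (s x).
  move=> h e g E; apply: vec_inj; apply: (addrI x); apply: inj; try exact: step_le.
  by rewrite !fs // E.
have sopp x e : (nrm x <= r)%N -> s x (opp e) = opp (s x e).
  move=> h; have h1 := leqW h; have h2 := leqW h1.
  (* An injective self-map of the finite set of directions is onto. *)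
  have [g sg] : exists g, s x g = opp (s x e).
    by exists (invF (sinj _ h1) (opp (s x e))); rewrite f_invF.
  have [gE|gne] := eqVneq g (opp e); first by rewrite -gE.
  have ge : g != e by apply/eqP => E; move: sg (opp_neq (s x e)); rewrite E => <-; rewrite eqxx.
  have he := step_le _ _ e h; have hg := step_le _ _ g h.
  have E : vec (s x e) + vec (s (x + vec e) g) = vec (s x g) + vec (s (x + vec g) e).
    by apply: (addrI (f x)); rewrite !addrA -!fs // addrAC.
  case: (common_neighbor E).
  - by move/(sinj _ h1) => eg; rewrite eg eqxx in ge.
  - move=> E0; have /inj : f (x + vec e + vec g) = f x by rewrite !fs // -addrA E0 addr0.
    move=> /(_ (step_le _ _ _ he) h2) /eqP; rewrite -addrA -subr_eq0 addrAC subrr add0r addrC.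
    rewrite addr_eq0 -vec_opp => /eqP /vec_inj gE.
    by rewrite gE eqxx in gne.
  - by rewrite sg.
have back x e : (nrm x <= r.+1)%N -> (nrm (x + vec e) <= r.+1)%N ->
    s (x + vec e) (opp e) = opp (s x e).
  move=> h he; apply: vec_inj; apply: (addrI (f (x + vec e))).
  by rewrite -fs // !vec_opp addrK fs // addrK.
have trans x e g : (nrm x <= r)%N -> (nrm (x + vec g) <= r)%N -> s (x + vec g) e = s x e.
  move=> h hg; have h1 := leqW h; have h2 := leqW h1; have hg1 := leqW hg.
  have [gE|ge] := eqVneq g e.
    by subst g; apply: (inv_inj (@oppK d)); rewrite -sopp // back.
  have [gE|gne] := eqVneq g (opp e).
    by subst g; have := back x (opp e) h1 hg1; rewrite oppK sopp // oppK.
  have E : vec (s x g) + vec (s (x + vec g) e) = vec (s x e) + vec (s (x + vec e) g).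
    by apply: (addrI (f x)); rewrite !addrA -!fs // ?step_le // addrAC.
  case: (common_neighbor E) => //.
  - by move/(sinj _ h1) => eg; rewrite eg eqxx in ge.
  move=> E0; have /inj : f (x + vec g + vec e) = f x by rewrite !fs // -addrA E0 addr0.
  move=> /(_ (step_le _ _ _ hg1) h2) /eqP; rewrite -addrA -subr_eq0 addrAC subrr add0r.
  rewrite addr_eq0 -vec_opp => /eqP /vec_inj gE.
  by rewrite gE eqxx in gne.
have sconst x e : (nrm x <= r)%N -> s x e = s 0 e.
  elim/nrm_ind: x => // y g ny IH h.
  have hy : (nrm y <= r)%N by rewrite -ltnS -ny ltnW // ltnS.
  by rewrite trans // IH.
pose M : 'M[int]_d := \matrix_i vec (s 0 (i, true)).
have vM e : vec e *m M = vec (s 0 e).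
  have vi i : vec (i, true) *m M = vec (s 0 (i, true)).
    have -> : vec (i, true) = delta_mx ord0 i by apply/rowP => j; rewrite !mxE eqxx /=; case: eqP.
    by rewrite -rowE rowK.
  case: e => i [] //; rewrite -[(i, false)]/(opp (i, true)) sopp ?nrm0 //.
  by rewrite !vec_opp mulNmx vi.
exists M.
  apply/matrixP => i j; rewrite !mxE.
  under eq_bigr do rewrite !mxE.
  rewrite (eq_bigr (fun k => vec (s 0 (i, true)) ord0 k * vec (s 0 (j, true)) ord0 k)); last first.
    by move=> k _; rewrite !mxE.
  rewrite dot_vec.
  have [<-|ij] := eqVneq i j; first by rewrite !eqxx.
  case: eqP => // E1.
  have n1 : s 0 (i, true) != s 0 (j, true).
    by apply: contra_neq ij => /sinj; rewrite nrm0 => /(_ isT) [].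
  have n2 : s 0 (i, true) != s 0 (opp (j, true)).
    by apply: contra_neq ij => /sinj; rewrite nrm0 => /(_ isT) [].
  rewrite sopp ?nrm0 // in n2.
  move: E1 n1 n2; case: (s _ _) => a b; case: (s _ _) => a' b' /= ->.
  by rewrite !xpair_eqE eqxx /=; case: b; case: b'.
elim/nrm_ind => [|y e ny IH h]; first by rewrite mul0mx addr0.
have hy : (nrm y <= r)%N by rewrite -ltnS -ny.
by rewrite fs ?sconst // ?(leqW hy) // IH ?(leqW hy) // mulmxDl vM addrA.
Qed.

End Rigidity.

(** * Lattice isometries as affine maps with orthogonal integer matrices *)

Section Isometries.
Variables (R : realType) (d : nat).
Implicit Types (x y z : 'rV[int]_d) (M : 'M[int]_d).

Definition affine (a : 'rV[int]_d * 'M[int]_d) x := a.1 + x *m a.2.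
Definition dot x y : int := (x *m y^T) ord0 ord0.

Lemma dotE x y : dot x y = \sum_i x ord0 i * y ord0 i.
Proof. by rewrite /dot mxE; apply: eq_bigr => i _; rewrite mxE. Qed.

Lemma dotC x y : dot x y = dot y x.
Proof. by rewrite !dotE; apply: eq_bigr => i _; rewrite mulrC. Qed.

Lemma dotDl x y z : dot (x + y) z = dot x z + dot y z.
Proof. by rewrite /dot mulmxDl mxE. Qed.

Lemma dotNl x y : dot (- x) y = - dot x y.
Proof. by rewrite /dot mulNmx mxE. Qed.

Lemma dotBB x y : dot (x - y) (x - y) = dot x x + dot y y - dot x y *+ 2.
Proof. by rewrite !(dotDl, dotNl) ![dot _ (_ - _)]dotC !(dotDl, dotNl) (dotC y x); ring. Qed.

Lemma dot_eq0 x : dot x x = 0 -> x = 0.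
Proof.
rewrite dotE => /eqP; rewrite psumr_eq0 => [/allP h|i _]; last by rewrite -expr2 sqr_ge0.
apply/rowP => i; rewrite mxE; have := h i (mem_index_enum _).
by rewrite mulf_eq0 orbb => /eqP.
Qed.

Lemma dot_mulmx M x y : M *m M^T = 1%:M -> dot (x *m M) (y *m M) = dot x y.
Proof. by move=> MM; rewrite /dot trmx_mul mulmxA -(mulmxA x) MM mulmx1. Qed.

Lemma euclidean_distE x y :
  euclidean_dist R x y = Num.sqrt (dot (x - y) (x - y))%:~R.
Proof.
rewrite /euclidean_dist dotE rmorph_sum /=; congr Num.sqrt.
by apply: eq_bigr => i _; rewrite !mxE -rmorphXn expr2.
Qed.

Lemma affine_isometry a : a.2 *m a.2^T = 1%:M -> lattice_isometry R (affine a).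
Proof.
move=> MM; have MM' := mulmx1C MM; split.
  exists (fun y => (y - a.1) *m a.2^T) => x; rewrite /affine.
    by rewrite addrC addKr -mulmxA MM mulmx1.
  by rewrite -mulmxA MM' mulmx1 addrC subrK.
move=> x y; rewrite !euclidean_distE /affine opprD addrACA subrr add0r.
by rewrite -mulmxBl dot_mulmx.
Qed.

(** By polarization [phi - phi 0] preserves dot products, so its difference with the linear map
    built on the images of the basis vectors has length zero. *)
Lemma isometry_affine (phi : site d -> site d) : lattice_isometry R phi ->
  exists2 a : 'rV[int]_d * 'M[int]_d, a.2 *m a.2^T = 1%:M & phi = affine a.
Proof.
case=> _ iso.
have dist x y : dot (phi x - phi y) (phi x - phi y) = dot (x - y) (x - y).
  have ge0 (u : 'rV[int]_d) : 0 <= ((dot u u)%:~R : R).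
    by rewrite ler0z dotE sumr_ge0 // => i _; rewrite -expr2 sqr_ge0.
  have := iso x y; rewrite !euclidean_distE => /(congr1 (fun t => t ^+ 2)).
  by rewrite !sqr_sqrtr // => /intr_inj.
have [g gE] : exists g, forall x, g x = phi x - phi 0 by exists (fun x => phi x - phi 0).
have gg x : dot (g x) (g x) = dot x x by rewrite gE dist subr0.
have gdot x y : dot (g x) (g y) = dot x y.
  have : dot (g x - g y) (g x - g y) = dot (x - y) (x - y).
    by rewrite -(dist x y) !gE opprB addrA subrK.
  by rewrite !dotBB !gg => /addrI /oppr_inj /eqP; rewrite eqrMn2r /= => /eqP.
pose M : 'M[int]_d := \matrix_i g (delta_mx ord0 i).
have rM i : row i M = g (delta_mx ord0 i) by rewrite rowK.
have MM : M *m M^T = 1%:M.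
  apply/matrixP => i j; rewrite !mxE.
  have := gdot (delta_mx ord0 i) (delta_mx ord0 j).
  rewrite !dotE => E; rewrite (eq_bigr (fun k => g (delta_mx ord0 i) ord0 k * g (delta_mx ord0
      j) ord0 k)).
    rewrite E (bigD1 i) //= big1 => [|k /negPf ki]; last by rewrite !mxE eqxx ki mul0r.
    by rewrite !mxE !eqxx addr0 mul1r.
  by move=> k _; rewrite !mxE.
have gM x : g x = x *m M.
  apply/eqP; rewrite -subr_eq0; apply/eqP/dot_eq0.
  rewrite dotBB gg dot_mulmx //.
  suff -> : dot (g x) (x *m M) = dot x x by rewrite mulr2n subrr.
  rewrite {1}/dot trmx_mul mulmxA [RHS]dotE mxE; apply: eq_bigr => i _.
  rewrite [x^T _ _]mxE; congr (_ * _).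
  have := gdot x (delta_mx ord0 i); rewrite {2}/dot.
  have -> : (x *m (delta_mx ord0 i : 'rV[int]_d)^T) ord0 ord0 = x ord0 i.
    rewrite mxE (bigD1 i) //= big1 => [|k /negPf ki]; last by rewrite !mxE eqxx ki mulr0.
    by rewrite !mxE !eqxx addr0 mulr1.
  move=> <-; rewrite /dot -rM !mxE; apply: eq_bigr => k _.
  by rewrite !mxE.
exists (phi 0, M) => //; apply/funext => x.
by rewrite /affine /= -gM gE addrC subrK.
Qed.

(** Replaces a quantifier over arbitrary bijections by one over a countable type, which makes
    equivalence with the scenery a measurable event. *)
Lemma scenery_equivE kappa (xi xi' : scenery d kappa) :
  scenery_equiv R xi xi' <->
  exists a : 'rV[int]_d * 'M[int]_d, a.2 *m a.2^T = 1%:M /\ forall x, xi (affine a x) = xi' x.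
Proof.
split=> [[phi [/isometry_affine[a Ma ->] h]]|[a [Ma h]]]; first by exists a.
by exists (affine a); split=> //; exact: affine_isometry.
Qed.

Lemma scenery_equiv_sym kappa (xi xi' : scenery d kappa) :
  scenery_equiv R xi xi' -> scenery_equiv R xi' xi.
Proof.
case=> phi [[[psi Kp Kq] iso] h]; exists psi; split; first split.
- by exists phi.
- by move=> x y; rewrite -iso !Kq.
- by move=> x; rewrite -h Kq.
Qed.

(** Adding the values at two opposite sites isolates twice the translation, and what remains is [m]
    times a row of the matrix; integers have no torsion. The sites used are those that [localizes]
    pins down. *)
Lemma affine_inj a a' (m : nat) : (0 < d)%N -> (0 < m)%N ->
  (forall e, affine a (vec e *+ m) = affine a' (vec e *+ m)) -> a = a'.
Proof.
move=> d0 m0 h; case: a a' h => [p M] [p' M'] h.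
have pp : p = p'.
  have e : dir d := (Ordinal d0, true).
  have := h e; have := h (opp e); rewrite /affine /= vec_opp mulNrn !mulNmx => h1 h2.
  have : p *+ 2 = p' *+ 2.
    transitivity ((p + vec e *+ m *m M) + (p - vec e *+ m *m M)).
      by rewrite addrACA subrr addr0 mulr2n.
    by rewrite h1 h2 addrACA subrr addr0 mulr2n.
  by move/matrixP => E; apply/rowP => j; have := E ord0 j; rewrite !mulmxnE => /eqP;
    rewrite eqrMn2r => /eqP.
rewrite -{}pp in h *; congr pair; apply/row_matrixP => i.
have := h (i, true); rewrite /affine /= => /addrI.
have -> : vec (i, true) = delta_mx ord0 i.
  by apply/rowP => j; rewrite !mxE eqxx /=; case: eqP.
rewrite -![_ *m _]/(mulmxr _ _) !raddfMn /= -!rowE => /matrixP E; apply/rowP => j.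
by have := E ord0 j; rewrite !mulmxnE => /eqP; rewrite eqrMn2r eqn0Ngt m0 => /eqP.
Qed.

End Isometries.

(** * Dictionaries of site labels *)

Section Dictionary.
Variables (d : nat) (C : Type).
Implicit Types (x y z : 'rV[int]_d) (e : dir d) (a b c : seq C).

Definition reads (xi : 'rV[int]_d -> C) x a := exists p, a = trace xi x p.

(* [Seen t a b c]: up to time [t], some particle had ancestors colored [a]
   (read backwards in time) and two lines of descendants colored [b] and [c]. *)
Variable Seen : nat -> seq C -> seq C -> seq C -> Prop.

Definition label : Type := seq C * seq C.

Definition branch N t (l : label) c := size c = N.+1 /\ Seen t l.1 l.2 c.

(* In the intended dictionary, [D x] consists of two opposite straight words leaving
   the site [x].  A word at [t2] stands for all words leaving that site, because
   the time scales [t1 < t2 < t3] are chosen so that everything at a site visited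
   by one time is seen by the next. *)
Record valid (N r t1 t2 t3 : nat) (D : 'rV[int]_d -> label)
    (eta : 'rV[int]_d -> C) : Prop := Valid {
  valid_size : forall x, (nrm x <= r)%N -> size (D x).1 = N.+1 /\ size (D x).2 = N.+1;
  valid_color : forall x, (nrm x <= r)%N -> ohead (D x).1 = Some (eta x);
  valid_seen : forall x, (nrm x <= r)%N -> exists c, branch N t1 (D x) c;
  valid_unambiguous : forall x, (nrm x <= r)%N -> forall c c',
    branch N t2 (D x) c -> branch N t2 (D x) c' -> Seen t3 c c' c';
  valid_distinct : forall x y, (nrm x <= r)%N -> (nrm y <= r)%N -> x <> y ->
    exists c c', [/\ branch N t1 (D x) c, branch N t1 (D y) c' & ~ Seen t2 c c' c'];
  valid_adjacent : forall x y, (nrm x <= r)%N -> (nrm y <= r)%N ->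
    nrm (x - y) = 1%N -> forall c c',
    branch N t2 (D x) c -> branch N t2 (D y) c' ->
    Seen t3 c (take 1 c ++ c') (take 1 c ++ c') }.

Variable xi : 'rV[int]_d -> C.

Definition sound := forall t a b c, Seen t a b c ->
  exists y, [/\ (nrm y <= t)%N, reads xi y a, reads xi y b & reads xi y c].

Definition complete (N t t' : nat) := forall y p1 p2 p3, (nrm y <= t)%N ->
  (size p1 <= N)%N -> (size p2 <= N)%N -> (size p3 <= N)%N ->
  Seen t' (trace xi y p1) (trace xi y p2) (trace xi y p3).

Definition straight_label (m : nat) e x : label :=
  (trace xi x (nseq (m + m) e), trace xi x (nseq (m + m) (opp e))).

Variables (m t0 t1 t2 t3 : nat) (e0 : dir d).
Let N := (m + m)%N.
Hypothesis seen_sound : sound.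
Hypothesis complete01 : complete N.+1 t0 t1.
Hypothesis complete12 : complete N.+1 t1 t2.
Hypothesis complete23 : complete N.+1 t2 t3.
Hypothesis loc : localizes xi t3.+1 m.
Hypotheses (t01 : (t0 <= t1)%N) (t12 : (t1 <= t2)%N) (t23 : (t2 <= t3)%N).

Let t13 : (t1 <= t3)%N. Proof. exact: leq_trans t23. Qed.
Let t02 : (t0 <= t2)%N. Proof. exact: leq_trans t12. Qed.
Let t03 : (t0 <= t3)%N. Proof. exact: leq_trans t13. Qed.

(** The reading path is at [y + vec e *+ m] at half time, and it had only [m] steps to get there
    from [z]. *)
Lemma reads_straight y z e : (nrm y <= t3.+1)%N -> (nrm z <= t3.+1)%N ->
  reads xi z (trace xi y (nseq N e)) -> (nrm ((y - z) + vec e *+ m)%R <= m)%N.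
Proof.
move=> yt zt [p E].
have sp : size p = N.
  by have := congr1 size E; rewrite !size_trace size_nseq => -[].
rewrite addrAC -(loc yt zt sp (esym E)).
apply: leq_trans (nrm_posB _ _) _.
by rewrite size_takel // sp leq_addr.
Qed.

Lemma straight_label_at x z e : (nrm x <= t3.+1)%N -> (nrm z <= t3.+1)%N ->
  reads xi z (straight_label m e x).1 -> reads xi z (straight_label m e x).2 -> z = x.
Proof.
move=> xt zt /(reads_straight xt zt) h1 /(reads_straight xt zt).
rewrite vec_opp mulNrn => /(sandwich h1) /eqP.
by rewrite subr_eq0 => /eqP.
Qed.

(* Two straight words pointing away from each other keep their ends too far apart
   for a single particle to read both. *)
Lemma straight_words_apart x y n : (nrm x <= t3.+1)%N -> (nrm y <= t3.+1)%N ->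
  exists e, forall z z', (nrm z <= t3.+1)%N -> (nrm z' <= t3.+1)%N ->
    (nrm (z - z')%R <= n)%N ->
    reads xi z (trace xi x (nseq N e)) ->
    reads xi z' (trace xi y (nseq N (opp e))) -> (nrm (x - y)%R <= n)%N.
Proof.
move=> xt yt.
(* With this sign of [e], the midpoints of the two words are [m + m] further apart than [x] and
   [y]. *)
have [e he] : exists e, 0 <= co e (x - y).
  have [h|h] := leP 0 (co e0 (x - y)); first by exists e0.
  by exists (opp e0); rewrite co_opp oppr_ge0 ltW.
exists e => z z' zt z't zz' /(reads_straight xt zt) h1 /(reads_straight yt z't).
rewrite vec_opp mulNrn -nrmN.
have -> : - (y - z' - vec e *+ m) = z' - y + vec e *+ m by rewrite opprD opprB opprK.
move=> h2.
have := nrm_push (m + m) he.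
have -> : x - y + vec e *+ (m + m) =
    (x - z + vec e *+ m) + (z' - y + vec e *+ m) + (z - z').
  by rewrite mulrnDr; move: (vec e *+ m) => w; apply/rowP => i; rewrite !mxE; ring.
move=> E; have := nrmD (x - z + vec e *+ m + (z' - y + vec e *+ m)) (z - z').
have := nrmD (x - z + vec e *+ m) (z' - y + vec e *+ m).
rewrite E; move: h1 h2 zz'.
by move: (nrm _) (nrm _) (nrm _) (nrm _) (nrm _) => i j k l o; clear; lia.
Qed.

Lemma valid_truth r : (r <= t0)%N ->
  valid N r t1 t2 t3 (straight_label m e0) xi.
Proof.
move=> rt.
have sz e : (size (nseq N e) <= N.+1)%N by rewrite size_nseq.
have inB x : (nrm x <= r)%N -> (nrm x <= t0)%N by move/leq_trans; exact.
have at_x t x c : (nrm x <= r)%N -> (t <= t3)%N ->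
    branch N t (straight_label m e0 x) c -> exists2 p, size p = N & c = trace xi x p.
  move=> /inB xr tt [sc] /seen_sound[z [zt za zb [p E]]].
  have zx : z = x.
    apply: straight_label_at za zb; first exact: leqW (leq_trans xr t03).
    exact: leqW (leq_trans zt tt).
  exists p; last by rewrite -zx.
  by move: sc; rewrite E size_trace => -[].
have seen_x x e : (nrm x <= r)%N -> branch N t1 (straight_label m e0 x) (trace xi x (nseq N e)).
  move=> xr; split; first by rewrite size_trace size_nseq.
  by apply: complete01 => //; exact: inB.
split.
- by move=> x xr; rewrite !size_trace !size_nseq.
- by move=> x xr /=; case: (nseq _ _).
- by move=> x xr; exists (trace xi x (nseq N e0)); exact: seen_x.
- move=> x xr c c' /(at_x _ _ _ xr t23)[p sp ->] /(at_x _ _ _ xr t23)[p' sp' ->].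
  by apply: complete23; rewrite ?sp ?sp' //; apply: leq_trans t02; exact: inB.
- move=> x y xr yr xy.
  have xt := leqW (leq_trans (inB _ xr) t03).
  have yt := leqW (leq_trans (inB _ yr) t03).
  have [e he] := straight_words_apart 0 xt yt.
  exists (trace xi x (nseq N e)), (trace xi y (nseq N (opp e))).
  split; try exact: seen_x.
  move=> /seen_sound[z [zt za zb _]]; apply: xy; apply/eqP; rewrite -subr_eq0; apply/eqP.
  apply: nrm_eq0; apply/eqP; rewrite -leqn0.
  by apply: (he z z) => //; rewrite ?subrr ?nrm0 //; exact: leqW (leq_trans zt t23).
- move=> x y xr yr /nrm1_vec[e xy] c c' /(at_x _ _ _ xr t23)[p sp ->] /(at_x _ _ _ yr t23)[p'
    sp' ->].
  (* Prepending the step between the neighbors gives a path of length [N.+1], which is why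
     completeness is assumed for one step more than the words of labels have. *)
  have -> : take 1 (trace xi x p) ++ trace xi y p' = trace xi x (opp e :: p').
    by rewrite take_trace take0 /= vec_opp -xy opprB addrC subrK.
  by apply: complete23; rewrite /= ?sp ?sp' //; apply: leq_trans t02; exact: inB.
Qed.

(** Nothing is known about [D], so the straight words needed for the contradictions are taken from
    the scenery itself, at the unknown sites where the labels were seen: [complete12] makes them
    branches of the labels at time [t2], hence subject to the tests. Their direction is chosen after
    the two sites. *)
Lemma valid_sound r D eta : valid N r.+2 t1 t2 t3 D eta ->
  exists2 A : 'rV[int]_d * 'M[int]_d, A.2 *m A.2^T = 1%:M /\ (nrm (affine A 0) <= t1)%N &
    forall x, (nrm x <= r.+1)%N -> eta x = xi (affine A x).
Proof.
move=> V.
pose at_ x y := [/\ (nrm y <= t1)%N, reads xi y (D x).1 & reads xi y (D x).2].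
have ex x : exists y, (nrm x <= r.+2)%N -> at_ x y.
  have [xr|] := leqP (nrm x) r.+2; last by exists 0.
  by have [c [_ /seen_sound[y [? ? ? _]]]] := valid_seen V xr; exists y.
have [f fP] := choice ex.
have path_of a y : size a = N.+1 -> reads xi y a -> exists2 p, size p = N & a = trace xi y p.
  by move=> sa [p E]; exists p => //; move: sa; rewrite E size_trace => -[].
have seen_y x y e : (nrm x <= r.+2)%N -> at_ x y -> branch N t2 (D x) (trace xi y (nseq N e)).
  move=> xr [yt ya yb]; have [sa sb] := valid_size V xr.
  split; first by rewrite size_trace size_nseq.
  have [p sp ->] := path_of _ _ sa ya; have [q sq ->] := path_of _ _ sb yb.
  by apply: complete12; rewrite ?sp ?sq ?size_nseq.
have uniq x y y' : (nrm x <= r.+2)%N -> at_ x y -> at_ x y' -> y = y'.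
  move=> xr hy hy'; have [yt _ _] := hy; have [y't _ _] := hy'.
  have [e he] := straight_words_apart 0 (leqW (leq_trans yt t13)) (leqW (leq_trans y't t13)).
  have /seen_sound[z [zt za zb _]] := valid_unambiguous V xr (seen_y _ _ e xr hy)
    (seen_y _ _ (opp e) xr hy').
  apply/eqP; rewrite -subr_eq0; apply/eqP; apply: nrm_eq0; apply/eqP; rewrite -leqn0.
  by apply: (he z z) => //; rewrite ?subrr ?nrm0 // leqW.
have at_f x c : (nrm x <= r.+2)%N -> branch N t1 (D x) c -> reads xi (f x) c.
  move=> xr [_ /seen_sound[y [yt ya yb yc]]].
  by rewrite (uniq x (f x) y) //; [exact: fP].
have [A MA fA] : exists2 M : 'M[int]_d, M *m M^T = 1%:M &
    forall x, (nrm x <= r.+1)%N -> f x = f 0 + x *m M.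
  have inj x y : (nrm x <= r.+2)%N -> (nrm y <= r.+2)%N -> f x = f y -> x = y.
    move=> xr yr E; apply: contrapT => xy.
    have [c [c' [hc hc' []]]] := valid_distinct V xr yr xy.
    have [p sp ->] := path_of _ _ (proj1 hc) (at_f _ _ xr hc).
    have [p' sp' ->] := path_of _ _ (proj1 hc') (at_f _ _ yr hc').
    by rewrite -E; apply: complete12; rewrite ?sp ?sp' //; case: (fP _ xr).
  apply: (rigidity _ inj) => x y xr yr xy.
  have [xt _ _] := fP _ xr; have [yt _ _] := fP _ yr.
  have [e he] := straight_words_apart 1 (leqW (leq_trans xt t13)) (leqW (leq_trans yt t13)).
  have := valid_adjacent V xr yr xy (seen_y _ _ e xr (fP _ xr)) (seen_y _ _ (opp e) yr (fP _ yr)).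
  rewrite take_trace take0 => /seen_sound[z [zt za [p zb] _]].
  case: p zb => [|g p] /= [_ zb]; first by case: (nseq _ _) zb.
  have le1 : (nrm (f x - f y)%R <= 1)%N.
    (* The neighbor of [z] may lie one step beyond radius [t3], which is why [loc] is assumed at
       [t3.+1]. *)
    apply: (he z (z + vec g)) => //.
    - exact: leqW.
    - by rewrite (leq_trans (nrmD _ _)) // nrm_vec addn1 ltnS.
    - by rewrite opprD addrA subrr add0r nrmN nrm_vec.
    - by exists p.
  apply/eqP; rewrite eqn_leq le1 lt0n; apply/eqP => /nrm_eq0 /eqP.
  rewrite subr_eq0 => /eqP /(inj _ _ xr yr) E.
  by move: xy; rewrite E subrr nrm0.
exists (f 0, A); first split => //.
  by rewrite /affine mul0mx addr0; case: (fP 0) => //; rewrite nrm0.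
move=> x xr; rewrite /affine /= -fA //.
have xr2 := leqW xr.
have [_ [p E] _] := fP _ xr2.
by have := valid_color V xr2; rewrite E; case: p {E} => [|g p] /= [].
Qed.

End Dictionary.

(** * Measurable selection of a consistent scenery *)

(** A box around the ball of radius [T], easier to count; the excess is harmless in union bounds. *)
Definition cube (d T : nat) : seq 'rV[int]_d :=
  [seq \row_i ((f i : nat)%:Z - T%:Z) | f : {ffun 'I_d -> 'I_(T + T).+1}].

Lemma size_cube d T : size (cube d T) = ((T + T).+1 ^ d)%N.
Proof. by rewrite size_image card_ffun !card_ord. Qed.

Lemma mem_cube d T x : (nrm x <= T)%N -> x \in cube d T.
Proof.
move=> h; apply/mapP; exists [ffun i => inord (absz (x ord0 i + T%:Z))]; first exact: mem_enum.
apply/rowP => i; rewrite mxE ffunE inordK.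
  by have := leq_trans (le_nrm x i) h; move: (x _ _) => a; lia.
by have := leq_trans (le_nrm x i) h; move: (x _ _) => a; lia.
Qed.

Section Events.
Variables (T : Type) (S : set (set T)).
Hypothesis sigmaS : sigma_algebra setT S.
Implicit Types P Q : T -> Prop.

(** The system [S] is a parameter because one calculus serves colored trees, the sample space and
    the blocks of driving variables. *)
Definition event P := S [set x | P x].

Lemma event_ext P Q : (forall x, P x <-> Q x) -> event P -> event Q.
Proof. by move=> E; rewrite /event; congr S; apply/seteqP; split=> x /= /E. Qed.

Lemma event_not P : event P -> event (fun x => ~ P x).
Proof. by move=> h; have [_ hC _] := sigmaS; have := hC _ h; rewrite setTD. Qed.

Lemma event_const (A : Prop) : event (fun=> A).
Proof.
have e0 : event (fun=> False) by have [h0 _ _] := sigmaS; exact: h0.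
have [h|h] := pselect A; last by apply: event_ext e0.
by apply: event_ext (event_not e0) => x; split=> // _ [].
Qed.

Lemma event_exists (I : countType) (P : I -> T -> Prop) :
  (forall i, event (P i)) -> event (fun x => exists i, P i x).
Proof.
move=> h; have [_ _ /(_ (fun n => [set x | if @choice.unpickle I n is Some i then P i x else
    False])) hU] := sigmaS.
have hn n : S [set x | if @choice.unpickle I n is Some i then P i x else False].
  by case: choice.unpickle => [i|]; [exact: h|exact: event_const].
have := hU hn; congr S; apply/seteqP; split => x /=.
  by case=> n _ /=; case: choice.unpickle => // i Pi; exists i.
by case=> i Pi; exists (choice.pickle i) => //=; rewrite choice.pickleK.
Qed.

Lemma event_forall (I : countType) (P : I -> T -> Prop) :
  (forall i, event (P i)) -> event (fun x => forall i, P i x).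
Proof.
move=> h; apply: (@event_ext (fun x => ~ exists i, ~ P i x)).
  by move=> x; split=> [/forallNP H i|H [i]]; [apply: contrapT; exact: H|exact].
by apply: event_not; apply: event_exists => i; exact: event_not.
Qed.

Lemma event_and P Q : event P -> event Q -> event (fun x => P x /\ Q x).
Proof.
move=> hP hQ; apply: (@event_ext (fun x => forall b : bool, if b then P x else Q x)).
  move=> x; split=> [h|[? ?] []//].
  by split; [exact: (h true)|exact: (h false)].
by apply: event_forall => -[].
Qed.

Lemma event_imply P Q : event P -> event Q -> event (fun x => P x -> Q x).
Proof.
move=> hP hQ; apply: (@event_ext (fun x => ~ (P x /\ ~ Q x))).
  by move=> x; split=> [h Px|h [Px]]; [apply: contrapT => nQ; exact: h|apply; exact: h].
by apply: event_not; apply: event_and => //; exact: event_not.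
Qed.

Lemma event_or P Q : event P -> event Q -> event (fun x => P x \/ Q x).
Proof.
move=> hP hQ; apply: (@event_ext (fun x => ~ P x -> Q x)).
  by move=> x; split=> [h|[]//]; have [|/h] := pselect (P x); [left|right].
by apply: event_imply => //; exact: event_not.
Qed.

End Events.

Lemma sigma_algebra_preimage_sub (T T' : Type) (S : set (set T)) (G : set (set T')) (f : T -> T') :
  sigma_algebra setT S -> (forall A, G A -> S (f @^-1` A)) ->
  forall A, <<s G >> A -> S (f @^-1` A).
Proof.
move=> sS fG; apply: smallest_sub; last exact: fG.
have [S0 SC SU] := sS; split=> [|A SA|A SA]; first by rewrite /= preimage_set0.
  by rewrite /= setTD -preimage_setC -setTD; exact: SC.
by rewrite /= preimage_bigcup; exact: SU.
Qed.

Lemma sigma_algebra_coordinate (I S T : Type) (coord : I -> S -> T) :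
  sigma_algebra setT (coordinate_sigma coord).
Proof. exact: smallest_sigma_algebra. Qed.

Lemma event_coordinate (I S T : Type) (coord : I -> S -> T) (i : I) (P : T -> Prop) :
  event (coordinate_sigma coord) (fun s => P (coord i s)).
Proof.
apply: sub_sigma_algebra; exists i => //; exists [set t | P t] => //.
by rewrite setTI.
Qed.

(** A finite word stands for a function on [X]. Words form a countable type, so existence of a
    function that matters at finitely many points becomes a countable union. *)
Definition pattern (X : countType) (C : Type) (c0 : C) (p : seq C) (x : X) : C :=
  nth c0 p (choice.pickle x).

Lemma patternP (X : countType) (C : Type) (c0 : C) (f : X -> C) n :
  exists p, forall x, (choice.pickle x < n)%N -> pattern c0 p x = f x.
Proof.
exists (mkseq (fun i => oapp f c0 (@choice.unpickle X i)) n) => x xn.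
by rewrite /pattern nth_mkseq ?choice.pickleK.
Qed.

(** * Greedy measurable choice of a solution of all constraints *)

Section Selection.
Variables (X : countType) (C : finType) (c0 : C) (T : Type) (S : set (set T)).
Hypothesis sigmaS : sigma_algebra setT S.
Variables (V : nat -> T -> (X -> C) -> Prop) (b : nat -> nat).
Hypothesis V_event : forall k f, event S (fun t => V k t f).
Hypothesis V_local : forall k t f g, (forall x, (choice.pickle x < b k)%N -> f x = g x) ->
  V k t f -> V k t g.

Notation pat := (@pattern X C c0).

(** Finitely many constraints at a time are demanded, and [q] may change with the horizon [K]; this
    keeps the condition a countable combination of events. *)
Definition extensible (k0 : nat) (p : seq C) (t : T) :=
  forall K, exists q, forall k, (k0 <= k <= K)%N -> V k t (pat (p ++ q)).

Lemma event_extensible k0 p : event S (extensible k0 p).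
Proof.
apply: event_forall => // K; apply: event_exists => // q; apply: event_forall => // k.
apply: event_imply; [exact: sigmaS|exact: (event_const sigmaS)|exact: V_event].
Qed.

Lemma pattern_nil_rcons p : pat (rcons p c0) = pat p.
Proof.
apply/funext => x; rewrite /pattern nth_rcons.
by case: ltngtP => [//|h|h]; rewrite nth_default // ?h // ltnW.
Qed.

(* Compactness: if no color extended [p], then some finite horizon would rule out
   all colors at once. *)
Lemma extensible_rcons k0 p t : extensible k0 p t ->
  exists c, extensible k0 (rcons p c) t.
Proof.
move=> h; apply: contrapT => /forallNP no.
have {}no c : exists K, forall q, ~ forall k, (k0 <= k <= K)%N -> V k t (pat (rcons p c ++ q)).
  by have /existsNP[K /forallNP] := no c; exists K.
have [K hK] := choice no.
have [q hq] := h (\max_c K c)%N.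
(* An empty extension has no first color, but appending the default color leaves the pattern
   unchanged. *)
have [c [q' hq']] : exists c q', pat (rcons p c ++ q') = pat (p ++ q).
  case: q {hq} => [|c q]; last by exists c, q; rewrite cat_rcons.
  by exists c0, [::]; rewrite !cats0 pattern_nil_rcons.
apply: (hK c q') => k /andP[k0k kK]; rewrite hq'; apply: hq.
by rewrite k0k (leq_trans kK) // leq_bigmax.
Qed.

Fixpoint greedy (k0 n : nat) (t : T) : seq C :=
  if n is n'.+1 then
    let p := greedy k0 n' t in
    rcons p (odflt c0 [pick c | `[< extensible k0 (rcons p c) t >]])
  else [::].

Lemma size_greedy k0 n t : size (greedy k0 n t) = n.
Proof. by elim: n => //= n IH; rewrite size_rcons IH. Qed.

Lemma greedy_extensible k0 n t : extensible k0 [::] t -> extensible k0 (greedy k0 n t) t.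
Proof.
move=> h; elim: n => //= n IH; case: pickP => [c /asboolP //|none].
by have [c /asboolP] := extensible_rcons IH; rewrite none.
Qed.

Lemma nth_greedy k0 n n' i t : (i < n)%N -> (i < n')%N ->
  nth c0 (greedy k0 n t) i = nth c0 (greedy k0 n' t) i.
Proof.
wlog: n n' / (n <= n')%N.
  by move=> H; have [/H h|/ltnW/H h] := leqP n n' => *; [exact: h|exact/esym/h].
move=> /subnK <-; elim: (n' - n)%N => // m IH i1 i2; rewrite addSn /= nth_rcons size_greedy.
by rewrite (leq_trans i1 (leq_addl _ _)) IH // (leq_trans i1 (leq_addl _ _)).
Qed.

Lemma event_greedy k0 n p : event S (fun t => greedy k0 n t = p).
Proof.
elim: n p => [|n IH] p /=; first exact: event_const.
pose E c q t := extensible k0 (rcons q c) t.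
(* Which colors are admissible depends on [t]: fixing the previous word [q] and the finite set [A]
   of admissible colors makes the choice constant on each of countably many pieces. *)
apply: (@event_ext _ _ (fun t => exists q : seq C, exists A : {set C},
  greedy k0 n t = q /\ (forall c, c \in A <-> E c q t) /\
  rcons q (odflt c0 [pick c in A]) = p)).
  move=> t; split=> [[q [A [-> [hA <-]]]]|<-].
    congr (rcons _ (odflt _ _)); apply: eq_pick => c /=.
    by apply/asboolP/idP => /hA.
  exists (greedy k0 n t), (finset (fun c => `[< E c (greedy k0 n t) t >])); split=> //; split.
    by move=> c; rewrite inE; split=> /asboolP.
  by congr (rcons _ (odflt _ _)); apply: eq_pick => c; rewrite inE.
apply: event_exists => // q; apply: event_exists => // A.
apply: event_and => //; apply: event_and => //; last exact: event_const.
apply: event_forall => // c; have [cA|cA] := boolP (c \in A).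
  apply: (@event_ext _ _ (E c q)); last exact: event_extensible.
  by move=> t; split=> // -[h _]; exact: h.
apply: (@event_ext _ _ (fun t => ~ E c q t)).
  by move=> t; split=> [h|[_ h] /h //]; split=> // /h.
by apply: event_not => //; exact: event_extensible.
Qed.

Lemma selection : exists L : T -> X -> C,
  (forall x (P : C -> Prop), event S (fun t => P (L t x))) /\
  forall t, (exists f k0, forall k, (k0 <= k)%N -> V k t f) ->
    exists k0, forall k, (k0 <= k)%N -> V k t (L t).
Proof.
(* The scale from which the constraints can be met is unknown; the least one is a measurable
   choice. *)
pose first k0 t := extensible k0 [::] t /\ forall k, (k < k0)%N -> ~ extensible k [::] t.
have ev_first k0 : event S (first k0).
  apply: event_and => //; first exact: event_extensible.
  apply: event_forall => // k; apply: event_imply => //; first exact: event_const.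
  by apply: event_not => //; exact: event_extensible.
have first_uniq t k k' : first k t -> first k' t -> k = k'.
  by move=> [e n] [e' n']; case: (ltngtP k k') => [/n'//|/n//|].
pose start t := xget 0%N [set k | first k t].
pose L t (x : X) := nth c0 (greedy (start t) (choice.pickle x).+1 t) (choice.pickle x).
have startP t k : first k t -> start t = k.
  by move=> h; apply: first_uniq (h); apply: (@xgetPex _ 0%N [set k | first k t]); exists k.
exists L; split.
  move=> x P; apply: (@event_ext _ _ (fun t => exists k0 p,
    ((first k0 t \/ (k0 = 0%N /\ forall k, ~ first k t)) /\
     greedy k0 (choice.pickle x).+1 t = p) /\ P (nth c0 p (choice.pickle x)))).
    move=> t; split.
      case=> k0 [p [[hk <-]]]; suff <- : start t = k0 by [].
      case: hk => [/startP //|[-> no]].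
      by apply: xgetPN => k; exact: no.
    move=> PL; exists (start t), (greedy (start t) (choice.pickle x).+1 t); split=> //; split=> //.
    have [[k hk]|/forallNP no] := pselect (exists k, first k t).
      by left; rewrite (startP _ _ hk).
    by right; split=> //; apply: xgetPN => k; exact: no.
  apply: event_exists => // k0; apply: event_exists => // p.
  apply: event_and => //; last exact: event_const.
  apply: event_and => //; last exact: event_greedy.
  apply: event_or => //; apply: event_and => //; first exact: event_const.
  by apply: event_forall => // k; exact: event_not.
move=> t [f [k0 hf]].
have ext0 : extensible k0 [::] t.
  move=> K; have [q hq] := patternP c0 f (\max_(k < K.+1) b k)%N.
  exists q => k /andP[k0k kK]; apply: V_local (hf k k0k) => x xb /=; rewrite hq //.
  by apply: leq_trans xb _; exact: (@leq_bigmax _ (fun i : 'I_K.+1 => b i) (Ordinal (kK : (k <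
      K.+1)%N))).
have [k1 hk1] : exists k, first k t.
  have ex : exists k, `[< extensible k [::] t >] by exists k0; apply/asboolP.
  exists (ex_minn ex); case: ex_minnP => k /asboolP ek kmin; split=> // j jk /asboolP ej.
  by have := kmin _ ej; rewrite leqNgt jk.
exists k1 => k k1k.
(* Whatever [q] witnesses extensibility of the prefix of length [b k] at horizon [k], the constraint
   [V k] depends only on that prefix, where [L t] agrees with it. *)
have [q hq] := greedy_extensible (b k) (proj1 hk1) k.
have {hq} := hq k; rewrite k1k leqnn => /(_ isT); apply: V_local => x xb.
rewrite /pattern nth_cat size_greedy xb /L (startP _ _ hk1).
exact: nth_greedy.
Qed.

End Selection.

(** * Independent blocks of random variables *)

Section Independence.
Context {disp : measure_display} {Omega : measurableType disp} {R : realType}.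
Variables (P : probability Omega R) (I : choiceType) (F : I -> set (set Omega)).
Hypothesis F_measurable : forall i, F i `<=` measurable.
Hypothesis F_setI : forall i A B, F i A -> F i B -> F i (A `&` B).
Hypothesis F_setT : forall i, F i setT.
Hypothesis F_indep : mutually_independent P F.

Definition block (J : set I) : set (set Omega) := <<s \bigcup_(i in J) F i >>.

Definition cylinders (J : set I) : set (set Omega) :=
  [set A | exists (K : {fset I}) (E : I -> set Omega),
    [/\ [set` K] `<=` J, forall i, F i (E i) & A = \bigcap_(i in [set` K]) E i]].

Lemma sigma_algebra_block J : sigma_algebra setT (block J).
Proof. exact: smallest_sigma_algebra. Qed.

Lemma block_measurable J : block J `<=` measurable.
Proof.
apply: smallest_sub; first exact: sigma_algebra_measurable.
by move=> A [i _ /F_measurable].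
Qed.

Lemma block_mono J J' : J `<=` J' -> block J `<=` block J'.
Proof.
move=> JJ'; apply: smallest_sub; first exact: sigma_algebra_block.
by move=> A [i Ji Fi]; apply: sub_sigma_algebra; exists i => //; exact: JJ'.
Qed.

Lemma cylinders_setT J : cylinders J setT.
Proof.
exists fset0, (fun=> setT); split=> //.
by apply/seteqP; split.
Qed.

Lemma cylinders_setI J : setI_closed (cylinders J).
Proof.
move=> _ _ [K [E [KJ FE ->]]] [K' [E' [K'J FE' ->]]].
pose E1 i := if i \in K then E i else setT.
pose E2 i := if i \in K' then E' i else setT.
exists (K `|` K')%fset, (fun i => E1 i `&` E2 i); split.
- by move=> i /=; rewrite in_fsetU => /orP[/KJ|/K'J].
- by move=> i; apply: F_setI; rewrite /E1 /E2; case: ifP.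
apply/seteqP; split=> w.
  by move=> [h h'] i _; rewrite /E1 /E2; split; case: ifP => // iK; first [exact: h|exact: h'].
move=> h; split=> i iK.
  have hi : [set` (K `|` K')%fset] i by rewrite /= in_fsetU iK.
  by have [+ _] := h i hi; rewrite /E1 iK.
have hi : [set` (K `|` K')%fset] i by rewrite /= in_fsetU iK orbT.
by have [_] := h i hi; rewrite /E2 iK.
Qed.

Lemma cylinders_measurable J : cylinders J `<=` measurable.
Proof.
move=> _ [K [E [_ FE ->]]]; apply: fin_bigcap_measurable => // i _.
exact: F_measurable (FE i).
Qed.

Lemma block_cylinders J : block J `<=` <<s cylinders J >>.
Proof.
apply: smallest_sub; first exact: smallest_sigma_algebra.
move=> A [i Ji FA]; apply: sub_sigma_algebra.
exists [fset i]%fset, (fun j => if j == i then A else setT); split.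
- by move=> j /=; rewrite inE => /eqP ->.
- by move=> j; case: eqP => [->|].
apply/seteqP; split=> [w Aw j /=|w]; first by rewrite inE => /eqP ->; rewrite eqxx.
by move=> /(_ i); rewrite eqxx; apply; rewrite /= inE.
Qed.

Lemma cylinders_indep J J' A B : J `&` J' = set0 ->
  cylinders J A -> cylinders J' B -> (P (A `&` B) = P A * P B)%E.
Proof.
move=> JJ' [K [E [KJ FE ->]]] [K' [E' [K'J FE' ->]]].
pose G i := if i \in K then E i else E' i.
have disj i : i \in K' -> i \notin K.
  move=> iK'; apply/negP => iK; have : (J `&` J') i by split; [exact: KJ|exact: K'J].
  by rewrite JJ'.
have -> : \bigcap_(i in [set` K]) E i `&` \bigcap_(i in [set` K']) E' i =
    \bigcap_(i in [set` (K `|` K')%fset]) G i.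
  apply/seteqP; split=> w.
    move=> [h h'] i /=; rewrite in_fsetU /G => /orP[iK|iK']; first by rewrite iK; exact: h.
    by rewrite (negPf (disj _ iK')); exact: h'.
  move=> h; split=> i iK; have := h i; rewrite /= in_fsetU iK ?orbT /G ?iK => /(_ isT) //.
  by rewrite (negPf (disj _ iK)).
rewrite !F_indep //; last by move=> i _; rewrite /G; case: ifP.
rewrite (perm_big (K ++ K')); last first.
  apply: uniq_perm; first exact: fset_uniq.
    rewrite cat_uniq !fset_uniq andbT /=; apply/hasPn => i; exact: disj.
  by move=> i; rewrite in_fsetU mem_cat.
rewrite big_cat /=; congr (_ * _)%E; apply: eq_big_seq => i iK; rewrite /G ?iK //.
by rewrite (negPf (disj _ iK)).
Qed.

(** Both sides are finite measures in [A], the restriction of [P] to [B] and a multiple of [P]; two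
    such measures that agree on a generating pi-system are equal. *)
Lemma indep_generated (G : set (set Omega)) (A B : set Omega) :
  G `<=` measurable -> setI_closed G -> G setT -> measurable B ->
  (forall A, G A -> P (A `&` B) = P A * P B)%E ->
  <<s G >> A -> (P (A `&` B) = P A * P B)%E.
Proof.
move=> Gm GI GT mB GB GA.
have r0 : 0 <= fine (P B) by rewrite fine_ge0.
have PB : P B = (fine (P B))%:E by rewrite fineK // fin_num_measure.
have -> : (P A * P B = mscale (NngNum r0) P A)%E by rewrite /mscale /= muleC -PB.
have cover : \bigcup_(k : nat) [set: Omega] = setT by rewrite bigcup_const //; exists 0%N.
apply: (g_sigma_algebra_measure_unique G Gm (fun=> setT) (fun=> GT) cover
  (mrestr P mB) (mscale (NngNum r0) P) GI) GA.
  by move=> C GC; transitivity (P C * P B)%E; [exact: GB|rewrite {1}PB muleC].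
by move=> k; change (P (setT `&` B) < +oo)%E; rewrite setTI PB ltry.
Qed.

(** The pi-system argument is applied to each side in turn, which leaves the product formula for
    cylinders. *)
Lemma block_indep J J' A B : J `&` J' = set0 -> block J A -> block J' B ->
  (P (A `&` B) = P A * P B)%E.
Proof.
move=> JJ' /block_cylinders bA bB; have mB := block_measurable bB.
apply: (indep_generated (@cylinders_measurable J)) bA => //.
- exact: cylinders_setI.
- exact: cylinders_setT.
move=> C cC; rewrite setIC muleC.
apply: (indep_generated (@cylinders_measurable J')) (block_cylinders bB) => //.
- exact: cylinders_setI.
- exact: cylinders_setT.
- exact: cylinders_measurable cC.
by move=> D cD; apply: cylinders_indep cD cC; rewrite setIC.
Qed.

Definition pr (Q : Omega -> Prop) : R := fine (P [set w | Q w]).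

Let sigma_m : sigma_algebra setT (measurable : set (set Omega)) := sigma_algebra_measurable _.

Lemma prE Q : event measurable Q -> P [set w | Q w] = (pr Q)%:E.
Proof. by move=> mQ; rewrite fineK // fin_num_measure. Qed.

Lemma pr_ge0 Q : 0 <= pr Q. Proof. exact: fine_ge0. Qed.

Lemma pr_ext Q Q' : (forall w, Q w <-> Q' w) -> pr Q = pr Q'.
Proof. by move=> E; congr (fine (P _)); apply/seteqP; split=> w /E. Qed.

Lemma pr_none Q : (forall w, ~ Q w) -> pr Q = 0.
Proof.
move=> h; rewrite /pr (_ : [set w | Q w] = set0) ?measure0 //.
by apply/seteqP; split=> // w /h.
Qed.

Lemma pr_mono Q Q' : event measurable Q -> event measurable Q' ->
  (forall w, Q w -> Q' w) -> pr Q <= pr Q'.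
Proof.
move=> mQ mQ' QQ'; rewrite -lee_fin -!prE //.
by apply: le_measure; rewrite ?inE.
Qed.

Lemma pr_le1 Q : event measurable Q -> pr Q <= 1.
Proof. by move=> mQ; rewrite -lee_fin -prE // probability_le1. Qed.

Lemma pr_not Q : event measurable Q -> pr (fun w => ~ Q w) = 1 - pr Q.
Proof.
move=> mQ; apply: EFin_inj; rewrite -prE; last exact: event_not.
by rewrite EFinB -prE // -probability_setC.
Qed.

Lemma pr_or_disjoint Q Q' : event measurable Q -> event measurable Q' ->
  (forall w, Q w -> ~ Q' w) -> pr (fun w => Q w \/ Q' w) = pr Q + pr Q'.
Proof.
move=> mQ mQ' QQ'; apply: EFin_inj; rewrite -prE; last exact: event_or.
rewrite EFinD -!prE // -measureU //.
by apply/seteqP; split=> // w [] /QQ'.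
Qed.

Lemma pr_or_le Q Q' : event measurable Q -> event measurable Q' ->
  pr (fun w => Q w \/ Q' w) <= pr Q + pr Q'.
Proof.
move=> mQ mQ'; pose N w := Q' w /\ ~ Q w.
have mN : event measurable N by apply: event_and => //; exact: event_not.
rewrite (pr_ext (Q' := fun w => Q w \/ N w)); last first.
  move=> w; split=> [[|]|[|[]]]; try by [left|right].
  by move=> q'; have [q|q] := pselect (Q w); [left|right].
rewrite pr_or_disjoint //; last by move=> w q [].
by rewrite lerD2l; apply: pr_mono => // w [].
Qed.

Lemma event_has (A : eqType) (s : seq A) (Q : A -> Omega -> Prop) :
  (forall a, a \in s -> event measurable (Q a)) ->
  event measurable (fun w => exists2 a, a \in s & Q a w).
Proof.
elim: s => [|a s IH] h.
  by apply: (@event_ext _ _ (fun=> False)); [move=> w; split=> [//|[]]|exact: event_const].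
apply: (@event_ext _ _ (fun w => Q a w \/ exists2 a, a \in s & Q a w)).
  move=> w; split=> [[q|[b bs q]]|[b]]; first by exists a; rewrite ?mem_head.
    by exists b; rewrite // inE bs orbT.
  by rewrite inE => /orP[/eqP ->|bs] q; [left|right; exists b].
apply: event_or => //; first by apply: h; exact: mem_head.
by apply: IH => b bs; apply: h; rewrite inE bs orbT.
Qed.

Lemma pr_has_le (A : eqType) (s : seq A) (Q : A -> Omega -> Prop) (c : R) :
  (forall a, a \in s -> event measurable (Q a)) ->
  (forall a, a \in s -> pr (Q a) <= c) ->
  pr (fun w => exists2 a, a \in s & Q a w) <= (size s)%:R * c.
Proof.
elim: s => [|a s IH] hm hc.
  by rewrite mul0r pr_none // => w [].
rewrite (pr_ext (Q' := fun w => Q a w \/ exists2 a, a \in s & Q a w)); last first.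
  move=> w; split=> [[b]|[q|[b bs q]]]; last 2 first.
  - by exists a; rewrite ?mem_head.
  - by exists b; rewrite // inE bs orbT.
  by rewrite inE => /orP[/eqP ->|bs] q; [left|right; exists b].
have hm' b : b \in s -> event measurable (Q b) by move=> bs; apply: hm; rewrite inE bs orbT.
apply: le_trans (pr_or_le _ _) _; [by apply: hm; exact: mem_head|exact: event_has|].
rewrite [size _]/= -nat1r mulrDl mul1r lerD ?hc ?mem_head // IH // => b bs.
by apply: hc; rewrite inE bs orbT.
Qed.

Lemma pr_fibers (A : finType) (f : Omega -> A) Q : event measurable Q ->
  (forall a, event measurable (fun w => f w = a)) ->
  \sum_a pr (fun w => Q w /\ f w = a) = pr Q.
Proof.
move=> mQ mf.
have mem_f (s : seq A) : event measurable (fun w => Q w /\ f w \in s).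
  apply: event_and => //.
  apply: (@event_ext _ _ (fun w => exists2 a, a \in s & f w = a)); last exact: event_has.
  by move=> w; split=> [[a ? ->]|?] //; exists (f w).
have main (s : seq A) : uniq s -> \sum_(a <- s) pr (fun w => Q w /\ f w = a) = pr (fun w => Q w
    /\ f w \in s).
  elim: s => [|a s IH] /=.
    by rewrite big_nil pr_none // => w [].
  case/andP => as_ us; rewrite big_cons IH // -pr_or_disjoint //; last 2 first.
  - exact: event_and.
  - by move=> w [_ ->] [_]; rewrite (negPf as_).
  apply: pr_ext => w; rewrite inE; split=> [[[q ->]|[q ->]]|[q /orP[/eqP|]]].
  - by rewrite eqxx.
  - by rewrite orbT.
  - by left.
  - by right.
rewrite -big_enum /= main ?enum_uniq //; apply: pr_ext => w.
by rewrite mem_enum; split=> [[]|].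
Qed.

Lemma block_event J Q : event (block J) Q -> event measurable Q.
Proof. exact: block_measurable. Qed.

Lemma pr_indep J J' Q Q' : J `&` J' = set0 ->
  event (block J) Q -> event (block J') Q' ->
  pr (fun w => Q w /\ Q' w) = pr Q * pr Q'.
Proof.
move=> JJ' bQ bQ'; have mQ := block_event bQ; have mQ' := block_event bQ'.
apply: EFin_inj; rewrite EFinM -!prE //; last exact: event_and.
exact: (block_indep JJ' bQ bQ').
Qed.

End Independence.

(** * The scenery and the branching walk *)

Inductive plan (d : nat) : Type :=
| Done
| Step of dir d & plan d
| Fork of dir d & plan d & dir d & plan d.
Arguments Done {d}.

(** A [Step] follows the first child, which exists whether or not the particle splits; only a [Fork]
    costs a factor [b]. *)
Fixpoint realized (d : nat) (split : particle -> bool) (jump : particle -> site d)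
    (v : particle) (s : plan d) : Prop :=
  match s with
  | Done => True
  | Step e s1 => jump (false :: v) = vec e /\ realized split jump (false :: v) s1
  | Fork e s1 f s2 => split v /\
      ((jump (false :: v) = vec e /\ realized split jump (false :: v) s1) /\
       (jump (true :: v) = vec f /\ realized split jump (true :: v) s2))
  end.

(* [hits x0 s n v x]: if [v] were at [x], some descendant of [v] after exactly [n]
   steps would be at [x0] and its own descendants would then follow the plan [s]. *)
Fixpoint hits (d : nat) (split : particle -> bool) (jump : particle -> site d)
    (x0 : 'rV[int]_d) (s : plan d) (n : nat) (v : particle) (x : 'rV[int]_d) : Prop :=
  match n with
  | 0 => x = x0 /\ realized split jump v s
  | n1.+1 => hits split jump x0 s n1 (false :: v) (x + jump (false :: v)) \/
      split v /\ hits split jump x0 s n1 (true :: v) (x + jump (true :: v))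
  end.

Section HittingBound.
Variables (R : realType) (d : nat) (b : R).

Fixpoint weight (s : plan d) : R :=
  match s with
  | Done => 1
  | Step _ s1 => (2 * d)%:R^-1 * weight s1
  | Fork _ s1 _ s2 => b * ((2 * d)%:R^-1 * weight s1 * ((2 * d)%:R^-1 * weight s2))
  end.

Definition average (q : 'rV[int]_d -> R) x : R := (2 * d)%:R^-1 * \sum_e q (x + vec e).

Definition branching (r : R) : R := 1 - (1 - r) * (1 - b * r).

(* A lower bound for the probability of [hits], when the plan succeeds with
   probability [r]: the branching recursion, with the dependence on the jump
   averaged out. *)
Fixpoint hit_bound (x0 : 'rV[int]_d) (r : R) (n : nat) : 'rV[int]_d -> R :=
  if n is n1.+1 then fun x => branching (average (hit_bound x0 r n1) x)
  else fun x => if x == x0 then r else 0.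

End HittingBound.

Section Model.
Context {disp : measure_display} {Omega : measurableType disp} {R : realType}.
Variables (P : probability Omega R) (d kappa : nat) (b : R).
Variables (xi : Omega -> scenery d kappa) (split : Omega -> particle -> bool)
  (jump : Omega -> particle -> site d).
Hypothesis model : scenery_and_BRW P b xi split jump.

Notation F := (driving_events xi split jump).
Notation blk := (block F).
Notation Pr := (pr P).
Notation index := ('rV[int]_d + (seq bool + seq bool))%type.

Let sigma_m : sigma_algebra setT (measurable : set (set Omega)) := sigma_algebra_measurable _.
Let sigma_b J : sigma_algebra setT (blk J) := sigma_algebra_block F J.

Lemma driving_setI i A B : F i A -> F i B -> F i (A `&` B).
Proof.
by case: i => [z|[v|v]] /= [C _ <-] [D _ <-]; exists (C `&` D) => //; rewrite !setTI preimage_setI.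
Qed.

Lemma driving_setT i : F i setT.
Proof. by case: i => [z|[v|v]] /=; exists setT => //; rewrite setTI preimage_setT. Qed.

Lemma event_xi (J : set index) z (Q : 'I_kappa -> Prop) :
  J (inl z) -> event (blk J) (fun w => Q (xi w z)).
Proof.
move=> Jz; apply: sub_sigma_algebra; exists (inl z) => //=.
by exists [set c | Q c] => //; rewrite setTI.
Qed.

Lemma event_split (J : set index) v : J (inr (inl v)) -> event (blk J) (fun w => split w v).
Proof.
move=> Jv; apply: sub_sigma_algebra; exists (inr (inl v)) => //=.
by exists [set c | is_true c] => //; rewrite setTI.
Qed.

Lemma event_jump (J : set index) v (Q : site d -> Prop) :
  J (inr (inr v)) -> event (blk J) (fun w => Q (jump w v)).
Proof.
move=> Jv; apply: sub_sigma_algebra; exists (inr (inr v)) => //=.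
by exists [set c | Q c] => //; rewrite setTI.
Qed.

Lemma prI (J J' : set index) Q Q' : J `&` J' = set0 ->
  event (blk J) Q -> event (blk J') Q' ->
  Pr (fun w => Q w /\ Q' w) = Pr Q * Pr Q'.
Proof.
move=> JJ'; apply: (pr_indep (driving_measurable model)) JJ'.
- exact: driving_setI.
- exact: driving_setT.
- exact: driving_independent model.
Qed.

Lemma mevent (J : set index) Q : event (blk J) Q -> event measurable Q.
Proof. by move=> h; exact: (block_event (driving_measurable model) h). Qed.

Lemma pr_xi z c : Pr (fun w => xi w z = c) = kappa%:R^-1.
Proof. by rewrite /pr (scenery_uniform model). Qed.

Lemma pr_split v : Pr (fun w => split w v) = b.
Proof. by rewrite /pr (split_law model). Qed.

Lemma nearest_neighbors_vec (e : dir d) : nearest_neighbors (0 : 'rV[int]_d) (vec e).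
Proof.
transitivity (nrm (vec e))%:Z; last by rewrite nrm_vec.
rewrite /nrm -natz natr_sum.
by apply: eq_bigr => i _; rewrite [X in X - _]mxE add0r normrN natz abszE.
Qed.

Lemma pr_jump v (e : dir d) : Pr (fun w => jump w v = vec e) = (2 * d)%:R^-1.
Proof. by rewrite /pr (jump_uniform model _ (nearest_neighbors_vec e)). Qed.

(** * Probability that a path and a straight path read the same word *)

Section Coincidence.
Variables (y z : 'rV[int]_d) (e : dir d).
Hypotheses (yz : y <> z) (zy : co e z <= co e y).

Lemma event_trace (J : set index) x p s :
  (forall i, (i <= size p)%N -> J (inl (pos x (take i p)))) ->
  event (blk J) (fun w => trace (xi w) x p = s).
Proof.
elim: p x s => [|f p IH] x s h /=.
  by apply: (@event_xi _ _ (fun c => [:: c] = s)); exact: (h 0%N).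
apply: (@event_ext _ (blk J) (fun w => xi w x :: behead s = s /\ trace (xi w) (x + vec f) p =
    behead s)).
  by move=> w; split=> [[{2}<- ->] //|<-].
apply: (event_and (sigma_b _)) => //.
  by apply: (@event_xi _ _ (fun c => c :: behead s = s)); exact: (h 0%N).
by apply: IH => i ip; exact: (h i.+1).
Qed.

(* Under [yz] and [zy] each new site of the straight path is fresh, so every
   further coincidence costs a factor [kappa^-1]. *)
Definition coincide p w := trace (xi w) z p = trace (xi w) y (nseq (size p) e).

Lemma event_coincide (J : set index) p :
  (forall i, (i <= size p)%N -> J (inl (pos z (take i p)))) ->
  (forall i, (i <= size p)%N -> J (inl (y + vec e *+ i))) ->
  event (blk J) (coincide p).
Proof.
move=> hz hy; apply: (@event_ext _ (blk J) (fun w => exists s : seq 'I_kappa,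
    trace (xi w) z p = s /\ trace (xi w) y (nseq (size p) e) = s)).
  by move=> w; rewrite /coincide; split=> [[s [-> ->]]|h] //; exists (trace (xi w) z p).
apply: (event_exists (sigma_b _)) => // s; apply: (event_and (sigma_b _)) => //;
    apply: event_trace => //.
by move=> i; rewrite size_nseq => ip; rewrite take_nseq // pos_nseq; exact: hy.
Qed.

Lemma pr_coincide p : Pr (coincide p) <= kappa%:R^-1 ^+ size p.
Proof.
elim/last_ind: p => [|p f IH].
  rewrite expr0; apply: pr_le1; apply: (@mevent setT); exact: event_coincide.
pose a := pos z p + vec f; pose c := y + vec e *+ (size p).+1.
(* The color at [c] affects neither [coincide p] nor the color at [a]. The path from [z] may cross
   itself and [a] may be an old site: it is the freshness of [c] that counts. *)
pose J : set index := [set i | i <> inl c].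
have E w : coincide (rcons p f) w <-> coincide p w /\ xi w a = xi w c.
  rewrite /coincide size_rcons -addn1 nseqD cats1 !trace_rcons pos_nseq.
  rewrite -addrA -mulrSr; split=> [/rcons_inj[-> ->]|[-> ->]] //.
have zc i : (i <= (size p).+1)%N -> J (inl (pos z (take i (rcons p f)))).
  move=> ip [] h; have := @straight_fresh _ e y z (rcons p f) i yz zy.
  by rewrite size_rcons => /(_ ip).
have ce : event (blk J) (coincide p).
  apply: event_coincide => i ip.
    by have := zc i (leqW ip); rewrite -cats1 takel_cat.
  move=> [] /addrI /(congr1 (co e)); rewrite !coMn co_vec => /eqP.
  by rewrite !natz eqz_nat => /eqP ie; rewrite ie ltnn in ip.
have ae k : event (blk J) (fun w => xi w a = k).
  apply: (@event_xi _ _ (fun k' => k' = k)).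
  by have := zc _ (leqnn _); rewrite take_oversize ?size_rcons // pos_rcons.
have cek k : event (blk [set inl c]) (fun w => xi w c = k).
  by apply: (@event_xi _ _ (fun k' => k' = k)).
rewrite (pr_ext P E) -(@pr_fibers _ _ _ P _ (fun w => xi w a)); last 2 first.
- apply: (event_and sigma_m); first exact: mevent ce.
  apply: (@event_ext _ _ (fun w => exists k, xi w a = k /\ xi w c = k)).
    by move=> w; split=> [[k [-> ->]]|->] //; exists (xi w c).
  apply: (event_exists sigma_m) => k; apply: (event_and sigma_m).
    exact: mevent (ae k).
  exact: mevent (cek k).
- by move=> k; exact: mevent (ae k).
rewrite (eq_bigr (fun k => Pr (fun w => coincide p w /\ xi w a = k) * kappa%:R^-1)); last first.
  move=> k _; rewrite -(pr_xi c k) -(@prI J [set inl c]).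
  - by apply: pr_ext => w; split=> [[[? <-] ->]|[[? ->] ->]].
  - by apply/seteqP; split=> // i [Ji /= iE].
  - exact: (event_and (sigma_b _)).
  - exact: cek.
rewrite -mulr_suml pr_fibers; last 2 first.
- exact: mevent ce.
- by move=> k; exact: mevent (ae k).
by rewrite size_rcons exprSr ler_wpM2r // invr_ge0.
Qed.

End Coincidence.

(** Union bound over two sites, a direction and [m] steps, the last two giving the exponent
    [m.+1]. *)
Lemma not_localizes_le (T m : nat) : exists N : Omega -> Prop,
  [/\ event measurable N,
     Pr N <= (((T + m + (T + m)).+1 ^ d) ^ 2 * (d * 2) ^ m.+1)%:R * kappa%:R^-1 ^+ m
   & forall w, ~ N w -> localizes (xi w) T m].
Proof.
pose c := cube d (T + m).
pose s := [seq (u, v) | u <- [seq (y, z) | y <- c, z <- c], v : dir d * m.-tuple (dir d) <-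
    enum {: _}].
pose Q (a : ('rV[int]_d * 'rV[int]_d) * (dir d * m.-tuple (dir d))) w :=
  [/\ a.1.1 <> a.1.2, co a.2.1 a.1.2 <= co a.2.1 a.1.1 & coincide a.1.1 a.1.2 a.2.1 a.2.2 w].
have mQ a : event measurable (Q a).
  apply: (@event_ext _ _ (fun w => (a.1.1 <> a.1.2 /\ co a.2.1 a.1.2 <= co a.2.1 a.1.1) /\
    coincide a.1.1 a.1.2 a.2.1 a.2.2 w)); first by move=> w; split=> [[[]]|[]].
  apply: (event_and sigma_m); first exact: event_const.
  by apply: (@mevent setT); exact: event_coincide.
exists (fun w => exists2 a, a \in s & Q a w); split.
- exact: event_has.
- have -> : (((T + m + (T + m)).+1 ^ d) ^ 2 * (d * 2) ^ m.+1)%N = size s.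
    rewrite !size_allpairs -cardE size_cube card_prod card_prod card_tuple card_prod.
    by rewrite card_ord card_bool mulnn [in LHS](expnS _ m).
  apply: pr_has_le => // -[[y z] [e p]] _.
  have [yz|/eqP yz] := eqVneq y z.
    by rewrite pr_none => [|w []]; rewrite ?exprn_ge0 ?invr_ge0.
  have [zy|zy] := leP (co e z) (co e y); last first.
    rewrite pr_none => [|w [_ /=]]; last by rewrite leNgt zy.
    by rewrite exprn_ge0 ?invr_ge0.
  rewrite (pr_ext P (Q' := coincide y z e p)); last by move=> w; split=> [[]|].
  by have := pr_coincide yz zy p; rewrite size_tuple.
move=> w nN; apply: localizesI => y z e p yT zT sp yz zy E; apply: nN.
have sp' : size p == m by apply/eqP.
exists ((y, z), (e, Tuple sp')).
  by apply: allpairs_f; [apply: allpairs_f; exact: mem_cube|exact: mem_enum].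
by split=> //=; rewrite /coincide /= sp.
Qed.

(** * Disjoint subtrees as independent blocks *)

Definition tree (v : particle) : set index := fun i =>
  match i with
  | inl _ => False
  | inr (inl u) => exists s, u = s ++ v
  | inr (inr u) => exists s, u = s ++ v
  end.

(** The jump of [v] itself is left out: what the descendants do relative to [v] is independent of
    the jump that brought [v] to its place. *)
Definition below v : set index := fun i => tree v i /\ i <> inr (inr v).

Lemma cat_cons_neq (T : eqType) (s : seq T) a v : s ++ a :: v <> v.
Proof. by move=> /(congr1 size); rewrite size_cat /=; lia. Qed.

Lemma tree_below a v : tree (a :: v) `<=` below v.
Proof.
move=> [z //|[u|u]] /= [s ->]; (split; first by exists (rcons s a); rewrite cat_rcons) => // -[].
exact: cat_cons_neq.
Qed.

Lemma below_tree v : below v `<=` tree v. Proof. by move=> i []. Qed.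

Lemma tree_disjoint v : tree (false :: v) `&` tree (true :: v) = set0.
Proof.
have neq (s s' : particle) : s ++ false :: v <> s' ++ true :: v.
  by move=> /(congr1 rev); rewrite !rev_cat !rev_cons !cat_rcons => /eqP; rewrite eqseq_cat // eqxx.
by apply/seteqP; split=> // -[z []//|[u|u]] /= [[s ->] [s']] /neq.
Qed.

Lemma event_mono (J J' : set index) Q : J `<=` J' -> event (blk J) Q -> event (blk J') Q.
Proof. by move=> JJ'; exact: block_mono. Qed.

Lemma jump_below_disjoint v : [set inr (inr v) : index] `&` below v = set0.
Proof. by apply/seteqP; split=> // i [-> []]. Qed.

Lemma split_tree_disjoint v :
  [set inr (inl v) : index] `&` (tree (false :: v) `|` tree (true :: v)) = set0.
Proof.
by apply/seteqP; split=> // i [->] /= [|] [s /esym /cat_cons_neq].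
Qed.

Lemma event_child a v e Q : event (blk (below (a :: v))) Q ->
  event (blk (tree (a :: v))) (fun w => jump w (a :: v) = vec e /\ Q w).
Proof.
move=> bQ; apply: (event_and (sigma_b _)).
  by apply: (@event_jump _ _ (fun u => u = vec e)); exists [::].
exact: event_mono (@below_tree _) bQ.
Qed.

Lemma pr_child a v e Q : event (blk (below (a :: v))) Q ->
  Pr (fun w => jump w (a :: v) = vec e /\ Q w) = (2 * d)%:R^-1 * Pr Q.
Proof.
move=> bQ; rewrite (prI (jump_below_disjoint (a :: v))) ?pr_jump //.
exact: (@event_jump _ _ (fun u => u = vec e)).
Qed.

Lemma realized_law v s :
  event (blk (below v)) (fun w => realized (split w) (jump w) v s) /\
  Pr (fun w => realized (split w) (jump w) v s) = weight b s.
Proof.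
elim: s v => [|e s IH|e s IH f s' IH'] v /=.
- split; first exact: event_const.
  rewrite (pr_ext P (Q' := fun=> ~ False)); last by move=> w; split=> // _ [].
  rewrite pr_not; last exact: (event_const sigma_m).
  by rewrite pr_none ?subr0 // => w [].
- have [ms ws] := IH (false :: v); split; last by rewrite pr_child // ws.
  by apply: event_mono (@tree_below _ _) (event_child _ ms).
have [ms ws] := IH (false :: v); have [ms' ws'] := IH' (true :: v).
have c0 := event_child e ms; have c1 := event_child f ms'.
have c01 : event (blk (tree (false :: v) `|` tree (true :: v))) (fun w =>
    (jump w (false :: v) = vec e /\ realized (split w) (jump w) (false :: v) s) /\
    (jump w (true :: v) = vec f /\ realized (split w) (jump w) (true :: v) s')).
  apply: (event_and (sigma_b _)); first exact: event_mono c0.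
  exact: event_mono c1.
have cs : event (blk [set inr (inl v)]) (fun w => split w v) by exact: event_split.
split.
  apply: (event_and (sigma_b _)).
    by apply: event_mono cs => i ->; split=> //; exists [::].
  apply: event_mono c01 => i []; exact: tree_below.
rewrite (prI (split_tree_disjoint v)) // pr_split (prI (tree_disjoint v)) //.
by rewrite !pr_child // ws ws'.
Qed.

(** An inequality, because the model gives the law of a jump at unit vectors only; other jumps are
    collected under [None]. It suffices for lower bounds on hitting, and with [Q] the event of a
    unit jump it later shows that other jumps are negligible. *)
Lemma sum_pr_jump_le v Q : event measurable Q ->
  \sum_e Pr (fun w => Q w /\ jump w v = vec e) <= Pr Q.
Proof.
move=> mQ; pose f w : option (dir d) := [pick e | jump w v == vec e].
have fE w e : f w = Some e <-> jump w v = vec e.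
  rewrite /f; case: pickP => [g /eqP ->|none]; split=> //.
  - by case=> ->.
  - by move=> /vec_inj ->.
  - by move=> E; have := none e; rewrite E eqxx.
have mf e : event measurable (fun w => f w = Some e).
  apply: (event_ext (fun w => iff_sym (fE w e))).
  by apply: (@mevent setT); exact: (@event_jump _ _ (fun u => u = vec e)).
rewrite -(@pr_fibers _ _ _ P _ f Q) //; last first.
  case=> [e|]; first exact: mf.
  apply: (@event_ext _ measurable (fun w => ~ exists e, f w = Some e)).
    move=> w; case: (f w) => [e|]; last by split=> // _ [].
    by split=> // h; case: h; exists e.
  by apply: (event_not sigma_m); exact: (event_exists sigma_m).
rewrite (bigID isSome) /= addrC ler_wpDl //; first by apply: sumr_ge0 => o _; exact: pr_ge0.
rewrite (reindex_omap (Some : dir d -> option (dir d)) id) /=; last by case.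
rewrite [leRHS](eq_bigl xpredT); last by move=> e; rewrite eqxx.
rewrite le_eqVlt; apply/orP; left; apply/eqP; apply: eq_bigr => e _.
by apply: pr_ext => w; rewrite fE.
Qed.

(** * Hitting probabilities dominate the branching recursion *)

Section Hitting.
Variables (x0 : 'rV[int]_d) (s : plan d).

Definition hit n v x w := hits (split w) (jump w) x0 s n v x.

Lemma event_hit n v x : event (blk (below v)) (hit n v x).
Proof.
elim: n v x => [|n IH] v x.
  by apply: (event_and (sigma_b _)); [exact: event_const|case: (realized_law v s)].
have child a : event (blk (below v)) (fun w => hit n (a :: v) (x + jump w (a :: v)) w).
  apply: (@event_ext _ (blk (below v)) (fun w => exists u : 'rV[int]_d, jump w (a :: v) = u /\
      hit n (a :: v) (x + u) w)).
    by move=> w; split=> [[u [->]]|h] //; exists (jump w (a :: v)).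
  apply: (event_exists (sigma_b _)) => u; apply: (event_and (sigma_b _)).
    by apply: (@event_jump _ _ (fun u' => u' = u)); apply: tree_below; exists [::].
  by apply: event_mono (IH _ _); apply: subset_trans (@tree_below a v); exact: below_tree.
apply: (event_or (sigma_b _)); first exact: child.
apply: (event_and (sigma_b _)); last exact: child.
by apply: event_split; split=> //; exists [::].
Qed.

Hypotheses (b0 : 0 <= b) (b1 : b <= 1).

Lemma event_hit_child n a v x :
  event (blk (tree (a :: v))) (fun w => hit n (a :: v) (x + jump w (a :: v)) w).
Proof.
apply: (@event_ext _ (blk (tree (a :: v))) (fun w => exists u : 'rV[int]_d,
    jump w (a :: v) = u /\ hit n (a :: v) (x + u) w)).
  by move=> w; split=> [[u [->]]|h] //; exists (jump w (a :: v)).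
apply: (event_exists (sigma_b _)) => u; apply: (event_and (sigma_b _)).
  by apply: (@event_jump _ _ (fun u' => u' = u)); exists [::].
by apply: event_mono (event_hit n (x + u)); exact: below_tree.
Qed.

Lemma pr_hit_child n a v x q : (forall y, q y <= Pr (hit n (a :: v) y)) ->
  average q x <= Pr (fun w => hit n (a :: v) (x + jump w (a :: v)) w).
Proof.
move=> hq; apply: le_trans (sum_pr_jump_le (a :: v) (mevent (@event_hit_child n a v x))).
rewrite /average mulr_sumr; apply: ler_sum => e _.
rewrite (pr_ext P (Q' := fun w => jump w (a :: v) = vec e /\ hit n (a :: v) (x + vec e) w)).
  by rewrite pr_child ?ler_wpM2l ?invr_ge0 //; exact: event_hit.
by move=> w; split=> [[+ E]|[E]]; rewrite E.
Qed.

Lemma pr_hit_ge n v x : hit_bound b x0 (weight b s) n x <= Pr (hit n v x).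
Proof.
elim: n v x => [|n IH] v x /=.
  case: eqP => [->|_]; last exact: pr_ge0.
  have [_ <-] := realized_law v s; rewrite le_eqVlt; apply/orP; left; apply/eqP.
  by apply: pr_ext => w; split=> [|[]].
set mu := average _ x.
have h0 := pr_hit_child x (IH (false :: v)); have h1 := pr_hit_child x (IH (true :: v)).
have e0 := @event_hit_child n false v x; have e1 := @event_hit_child n true v x.
have es : event (blk [set inr (inl v)]) (fun w => split w v) by exact: event_split.
set A := (fun w => hit n (false :: v) _ w) in h0 e0.
set B := (fun w => hit n (true :: v) _ w) in h1 e1.
have eB : event (blk ([set inr (inl v)] `|` tree (true :: v))) (fun w => split w v /\ B w).
  by apply: (event_and (sigma_b _)); [apply: event_mono es|apply: event_mono e1] => i; [left|right].
have prB : Pr (fun w => split w v /\ B w) = b * Pr B.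
  rewrite -(pr_split v) (prI _ es e1) //.
  apply/seteqP; split=> // i [si ti]; rewrite -(split_tree_disjoint v).
  by split=> //; right.
(* The target is missed when the first child fails and the second is either absent or fails, two
   events of disjoint blocks. *)
have -> : Pr (hit n.+1 v x) = 1 - (1 - Pr A) * (1 - b * Pr B).
  rewrite -prB -!pr_not; try by [exact: mevent e0|exact: mevent eB].
  rewrite -(prI _ (event_not (sigma_b _) e0) (event_not (sigma_b _) eB)); last first.
    apply/seteqP; split=> // i [ti [si|ti']]; last by rewrite -(tree_disjoint v).
    by rewrite -(split_tree_disjoint v); split=> //; left.
  rewrite -pr_not; last first.
    by apply: (event_and sigma_m); apply: (event_not sigma_m); [exact: mevent e0|exact: mevent eB].
  apply: pr_ext => w; split=> [[a [na nb]|ab [na nb]]|h]; [exact: na|exact: nb|].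
  have [a|na] := pselect (A w); first by left.
  by right; apply: contrapT => nab; exact: h.
have p0 := pr_le1 P (mevent e0); have p1 := pr_le1 P (mevent e1).
rewrite /branching lerD2l lerN2 ler_pM ?subr_ge0 //.
- by apply: le_trans p1; rewrite ler_piMl // pr_ge0.
- by rewrite lerD2l lerN2.
by rewrite lerD2l lerN2 ler_wpM2l.
Qed.

End Hitting.

End Model.

(** * Growth of the hitting probabilities *)

Lemma nrm_parity d (x : 'rV[int]_d) e : odd (nrm (x + vec e)) = ~~ odd (nrm x).
Proof.
have [h|h] := leP 0 (co e x).
  by have := nrm_push 1 h; rewrite mulr1n addn1 => ->.
have h' : 0 <= co (opp e) (x + vec e).
  by rewrite co_opp coD co_vec; move: (co e x) h => a; lia.
by have := nrm_push 1 h'; rewrite mulr1n vec_opp addrK addn1 => -> /=; rewrite negbK.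
Qed.

Section HitBound.
Variables (R : realType) (d : nat) (b : R).
Hypotheses (d0 : (0 < d)%N) (b0 : 0 < b) (b1 : b <= 1).
Implicit Types (x y : 'rV[int]_d) (q : 'rV[int]_d -> R).

Notation deg := ((2 * d)%:R : R).

Lemma deg_gt0 : 0 < deg.
Proof. by rewrite ltr0n muln_gt0. Qed.

Lemma sum_dir_const (c : R) : \sum_(e : dir d) c = deg * c.
Proof. by rewrite sumr_const card_prod card_ord card_bool mulnC mulr_natl. Qed.

Lemma average_ge (q : 'rV[int]_d -> R) (c : R) x : (forall e, c <= q (x + vec e)) -> c <=
    average q x.
Proof.
move=> h; rewrite /average mulrC ler_pdivlMr ?deg_gt0 // mulrC -sum_dir_const.
exact: ler_sum.
Qed.

Lemma average_le (q : 'rV[int]_d -> R) (c : R) x : (forall e, q (x + vec e) <= c) -> average q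
    x <= c.
Proof.
move=> h; rewrite /average mulrC ler_pdivrMr ?deg_gt0 // mulrC -sum_dir_const.
exact: ler_sum.
Qed.

Lemma average_ge1 (q : 'rV[int]_d -> R) x e : (forall y, 0 <= q y) ->
  deg^-1 * q (x + vec e) <= average q x.
Proof.
move=> h; rewrite /average ler_wpM2l ?invr_ge0 // (bigD1 e) //= lerDl.
by apply: sumr_ge0.
Qed.

Lemma branching_mono (r s : R) : 0 <= r -> r <= s -> s <= 1 -> branching b r <= branching b s.
Proof.
move=> r0 rs s1; have bs : b * r <= b * s by rewrite ler_wpM2l // ltW.
have bs1 : b * s <= 1 by apply: le_trans s1; rewrite ler_piMl // (le_trans r0).
by rewrite /branching lerD2l lerN2 ler_pM ?subr_ge0 // lerD2l lerN2.
Qed.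

Lemma branching_itv (r : R) : 0 <= r <= 1 -> 0 <= branching b r <= 1.
Proof.
move=> /andP[r0 r1]; have br0 : 0 <= b * r by rewrite mulr_ge0 // ltW.
have br1 : b * r <= 1 by apply: le_trans r1; rewrite ler_piMl.
rewrite /branching subr_ge0 gerBl mulr_ge0 ?subr_ge0 // andbT.
by rewrite mulr_ile1 ?subr_ge0 ?gerBl.
Qed.

Lemma branching_ge (r : R) : 0 <= r <= 1 -> r <= branching b r.
Proof.
move=> /andP[r0 r1]; have : 0 <= (1 - r) * (b * r).
  by rewrite mulr_ge0 ?subr_ge0 // mulr_ge0 // ltW.
by rewrite /branching; lra.
Qed.

Lemma branching_growth (r : R) : 0 <= r -> r <= 2^-1 -> (1 + b / 2) * r <= branching b r.
Proof.
move=> r0 r2; have : 0 <= b * r * (2^-1 - r).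
  by rewrite !mulr_ge0 ?subr_ge0 // ltW.
by rewrite /branching; lra.
Qed.

Section Target.
Variables (x0 : 'rV[int]_d) (r : R).
Hypotheses (r0 : 0 <= r) (r1 : r <= 1).
Notation Q := (hit_bound b x0 r).

Lemma hit_bound_itv n x : 0 <= Q n x <= 1.
Proof.
elim: n x => [|n IH] x /=; first by case: eqP; rewrite ?r0 ?lexx ?ler01.
apply: branching_itv; apply/andP; split.
  by apply: average_ge => e; have /andP[] := IH (x + vec e).
by apply: average_le => e; have /andP[] := IH (x + vec e).
Qed.

Lemma hit_boundS n x (c : R) : 0 <= c -> c <= average (Q n) x ->
  branching b c <= Q n.+1 x.
Proof.
move=> c0 h; apply: branching_mono => //; apply: average_le => e.
by have /andP[] := hit_bound_itv n (x + vec e).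
Qed.

(** Follows one walk that approaches [x0], stepping away when it is already there, at a factor
    [deg^-1] per step. Each step flips the parity of the distance, hence the parity condition here
    and below. *)
Lemma hit_bound_spread n x : (nrm (x - x0) <= n)%N ->
  odd (nrm (x - x0)) = odd n -> r * deg^-1 ^+ n <= Q n x.
Proof.
elim: n x => [|n IH] x.
  by rewrite leqn0 expr0 mulr1 /= => /eqP /nrm_eq0 /eqP; rewrite subr_eq0 => ->.
move=> xn par.
have [e he] : exists e, (nrm (x + vec e - x0) <= n)%N.
  case: (eqVneq x x0) xn par => [->|xx0] xn par.
    have e : dir d := (Ordinal d0, true).
    exists e; rewrite addrC addKr nrm_vec.
    by case: n xn par {IH} => //; rewrite subrr nrm0.
  have [e ce] : exists e, co e (x - x0) < 0.
    apply: contrapT => /forallNP h; move/eqP: xx0; apply; apply/eqP; rewrite -subr_eq0.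
    apply/eqP/rowP => i; rewrite [RHS]mxE; have := h (i, true); have := h (i, false).
    by rewrite /co /=; move: ((x - x0) ord0 i) => a; lia.
  exists e; rewrite -ltnS; apply: leq_trans xn.
  have h' : 0 <= co (opp e) (x - x0 + vec e).
    by rewrite co_opp coD co_vec; move: (co e _) ce => a; lia.
  by have := nrm_push 1 h'; rewrite mulr1n vec_opp addrK addn1 addrAC => ->.
have IHe : r * deg^-1 ^+ n <= Q n (x + vec e).
  apply: IH => //; rewrite addrAC nrm_parity par /=; exact: negbK.
have c0 : 0 <= r * deg^-1 ^+ n.+1 by rewrite mulr_ge0 // exprn_ge0 // invr_ge0.
have h : r * deg^-1 ^+ n.+1 <= average (Q n) x.
  apply: le_trans (average_ge1 x e _); last by move=> y; have /andP[] := hit_bound_itv n y.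
  by rewrite exprS mulrCA ler_wpM2l // invr_ge0.
apply: le_trans (hit_boundS c0 h); apply: branching_ge; rewrite c0.
apply: le_trans h _; apply: average_le => y.
by have /andP[] := hit_bound_itv n (x + vec y).
Qed.

(** * Growth of a small bump, then saturation *)

Section Tent.
Variables (D : nat).
Hypothesis D0 : (0 < D)%N.

(* A product of tents satisfies [average f >= (1 - 1/D) * f] and has finite support:
   a small multiple of it lies below the hitting probabilities after finitely many
   steps, and the branching recursion then makes that multiple grow. *)
Definition tent (u : int) : R := Num.max 0 (1 - `|u|%:~R / D%:R).

Lemma tent_ge0 u : 0 <= tent u. Proof. by rewrite /tent le_max lexx. Qed.

Lemma tent_le1 u : tent u <= 1.
Proof. by rewrite /tent ge_max ler01 gerBl divr_ge0 // ler0z. Qed.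

(** A tent is convex except at its apex, so averaging loses only there, and the loss is the relative
    amount [D^-1]. *)
Lemma tent_average u : (1 - D%:R^-1) * tent u * 2 <= tent (u + 1) + tent (u - 1).
Proof.
have Dp : 0 < (D%:R : R) by rewrite ltr0n.
have iD0 : 0 < (D%:R^-1 : R) by rewrite invr_gt0.
have iD1 : D%:R^-1 <= 1 :> R by rewrite invf_le1 // ler1n.
have [h|h] := leP (1 - `|u|%:~R / D%:R : R) 0.
  by rewrite {1}/tent (max_idPl h) mulr0 mul0r addr_ge0 ?tent_ge0.
rewrite {1}/tent (max_idPr (ltW h)).
have t v : 1 - `|v|%:~R / D%:R <= tent v by rewrite /tent le_max lexx orbT.
apply: le_trans (lerD (t _) (t _)).
have [->|u0] := eqVneq u 0.
  by rewrite normr0 add0r sub0r normrN normr1 mul0r subr0 mulr1 div1r; lra.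
have -> : 1 - `|u + 1|%:~R / D%:R + (1 - `|u - 1|%:~R / D%:R) = (1 - `|u|%:~R / D%:R) * 2 :> R.
  rewrite addrACA -opprD -mulrDl -intrD.
  have -> : (`|u + 1| + `|u - 1| = `|u| * 2)%R by lia.
  by rewrite intrM; lra.
by rewrite -mulrA ler_piMl ?mulr_ge0 ?ltW //; lra.
Qed.

Definition bump x : R := \prod_i tent ((x - x0) ord0 i).

Lemma bump_ge0 x : 0 <= bump x.
Proof. by apply: prodr_ge0 => i _; exact: tent_ge0. Qed.

Lemma bump_le1 x : bump x <= 1.
Proof. by apply: prodr_ile1 => i _; rewrite tent_ge0 tent_le1. Qed.

Lemma bump_support x : (d * D < nrm (x - x0)%R)%N -> bump x = 0.
Proof.
move=> h; have [i hi] : exists i, (D <= absz ((x - x0)%R ord0 i))%N.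
  apply: contrapT => /forallNP no; move: h; rewrite ltnNge => /negP; apply.
  rewrite -[d in (d * D)%N]card_ord -sum_nat_const; apply: leq_sum => i _.
  by have /negP := no i; rewrite -ltnNge => /ltnW.
rewrite /bump (bigD1 i) //= {1}/tent (max_idPl _) ?mul0r //.
by rewrite subr_le0 ler_pdivlMr ?ltr0n // mul1r -abszE -pmulrn ler_nat.
Qed.

Lemma bump_center x : (2 * nrm (x - x0)%R <= D)%N -> 2^-1 ^+ d <= bump x.
Proof.
move=> h; rewrite /bump -[d in _ ^+ d]card_ord -prodr_const; apply: ler_prod => i _.
have hi : (2 * absz ((x - x0)%R ord0 i))%:R <= D%:R :> R.
  by rewrite ler_nat; apply: leq_trans h; rewrite leq_mul2l le_nrm orbT.
rewrite invr_ge0 ler0n /= /tent le_max -abszE -pmulrn; apply/orP; right.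
suff : (absz ((x - x0)%R ord0 i))%:R / D%:R <= 2^-1 :> R by lra.
by rewrite ler_pdivrMr ?ltr0n // ler_pdivlMl // -natrM.
Qed.

(** Opposite directions are paired by axis: such a pair changes a single factor of the product, to
    which [tent_average] applies. *)
Lemma bump_average x : (1 - D%:R^-1) * bump x <= average bump x.
Proof.
rewrite /average mulrC ler_pdivlMl ?deg_gt0 //.
have -> : \sum_e bump (x + vec e) = \sum_(i < d) (bump (x + vec (i, true)) + bump (x + vec (i,
    false))).
  rewrite (eq_bigr (fun e : dir d => bump (x + vec (e.1, e.2)))); last by case.
  rewrite -(pair_bigA _ (fun i s => bump (x + vec (i, s)))) /=.
  by apply: eq_bigr => i _; rewrite big_bool.
have -> : deg * (bump x * (1 - D%:R^-1)) = \sum_(i < d) ((1 - D%:R^-1) * bump x * 2).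
  by rewrite sumr_const card_ord -mulr_natl natrM; ring.
apply: ler_sum => i _; rewrite /bump (bigD1 i) //= [X in _ <= X + _](bigD1 i) //= [X in _ <= _
    + X](bigD1 i) //=.
set p := (X in tent _ * X).
have E s : \prod_(j < d | j != i) tent ((x + vec (i, s) - x0) ord0 j) = p.
  by apply: eq_bigr => j /negPf ji; rewrite !mxE /= ji addr0.
rewrite !E -mulrDl mulrA mulrAC ler_wpM2r //.
  by apply: prodr_ge0 => j _; exact: tent_ge0.
have -> : (x + vec (i, true) - x0) ord0 i = (x - x0) ord0 i + 1.
  by rewrite !mxE /= eqxx addrAC.
have -> : (x + vec (i, false) - x0) ord0 i = (x - x0) ord0 i - 1.
  by rewrite !mxE /= eqxx addrAC.
exact: tent_average.
Qed.

Hypothesis D_large : 1 + b / 4 <= (1 + b / 2) * (1 - D%:R^-1).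

(** A step loses [1 - D^-1] by averaging and gains [1 + b / 2] by branching, a net gain by
    [D_large]. The cap at one half is where the linear gain of [branching_growth] ends. *)
Lemma hit_bound_growth (c : R) n0 j x : 0 <= c ->
  (forall y, odd (nrm (y - x0)) = odd n0 -> c * bump y <= Q n0 y) ->
  odd (nrm (x - x0)) = odd (n0 + j) ->
  Num.min 2^-1 (c * (1 + b / 4) ^+ j) * bump x <= Q (n0 + j) x.
Proof.
move=> c0 h; set g := 1 + b / 4; elim: j x => [|j IH] x.
  rewrite addn0 expr0 mulr1 => /h; apply: le_trans.
  by rewrite ler_wpM2r ?bump_ge0 // ge_min lexx orbT.
rewrite addnS /= => par; set C := Num.min 2^-1 (c * g ^+ j).
have g1 : 1 <= g by rewrite /g lerDl divr_ge0 // ltW.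
have gj : 0 <= c * g ^+ j by rewrite mulr_ge0 // exprn_ge0 // (le_trans ler01).
have C0 : 0 <= C by rewrite /C le_min gj invr_ge0 ler0n.
have C2 : C <= 2^-1 by rewrite /C ge_min lexx.
have IHe e : C * bump (x + vec e) <= Q (n0 + j) (x + vec e).
  by apply: IH; rewrite addrAC nrm_parity par negbK.
have av : C * average bump x <= average (Q (n0 + j)) x.
  rewrite /average mulrCA ler_wpM2l ?invr_ge0 // mulr_sumr.
  by apply: ler_sum => e _; exact: IHe.
have iD1 : D%:R^-1 <= 1 :> R by rewrite invf_le1 ?ltr0n // ler1n.
have iD0 : 0 <= (D%:R^-1 : R) by rewrite invr_ge0.
have bx0 := bump_ge0 x; have bx1 := bump_le1 x.
set m := C * ((1 - D%:R^-1) * bump x).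
have m0 : 0 <= m by rewrite !mulr_ge0 // subr_ge0.
have m2 : m <= 2^-1.
  by apply: le_trans C2; rewrite /m ler_piMr // mulr_ile1 ?subr_ge0 //.
have mav : m <= average (Q (n0 + j)) x.
  by apply: le_trans av; rewrite ler_wpM2l // bump_average.
apply: le_trans (hit_boundS m0 mav); apply: le_trans (branching_growth m0 m2).
have -> : (1 + b / 2) * m = C * ((1 + b / 2) * (1 - D%:R^-1)) * bump x by rewrite /m; ring.
rewrite ler_wpM2r //.
apply: le_trans (_ : C * g <= _); last by rewrite ler_wpM2l.
rewrite /C minr_pMl ?(le_trans ler01) // le_min !ge_min.
by rewrite exprSr mulrA lexx orbT andbT ler_peMr ?invr_ge0.
Qed.

(** Within the ball where [delta] is guaranteed, the second child multiplies the failure probability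
    by at most [1 - b * delta] per step; the walk must not leave this ball in [j] steps. *)
Lemma hit_bound_saturate (delta : R) n0 j x : 0 <= delta <= 1 ->
  (forall y, (2 * nrm (y - x0)%R <= D)%N -> odd (nrm (y - x0)) = odd n0 -> delta <= Q n0 y) ->
  (2 * (nrm (x - x0)%R + j) <= D)%N -> odd (nrm (x - x0)) = odd (n0 + j) ->
  1 - (1 - delta) * (1 - b * delta) ^+ j <= Q (n0 + j) x.
Proof.
move=> /andP[de0 de1] h; elim: j x => [|j IH] x.
  by rewrite !addn0 expr0 mulr1 subKr => *; exact: h.
rewrite !addnS /= => xD par; set q := 1 - (1 - delta) * (1 - b * delta) ^+ j.
have bd0 : 0 <= b * delta by rewrite mulr_ge0 // ltW.
have bd1 : b * delta <= 1 by rewrite -[leRHS]mulr1 ler_pM // ltW.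
have s0 : 0 <= (1 - b * delta) ^+ j by rewrite exprn_ge0 // subr_ge0.
have s1 : (1 - b * delta) ^+ j <= 1 by rewrite exprn_ile1 ?subr_ge0 // gerBl.
have dq : delta <= q by rewrite /q; nra.
have q1 : q <= 1 by rewrite /q gerBl mulr_ge0 // subr_ge0.
have q0 : 0 <= q by exact: le_trans dq.
have av : q <= average (Q (n0 + j)) x.
  apply: average_ge => e; apply: IH; last by rewrite addrAC nrm_parity par negbK.
  apply: leq_trans xD; rewrite leq_mul2l /= -addSn leq_add2r.
  by rewrite addrAC (leq_trans (nrmD _ _)) // nrm_vec addn1.
apply: le_trans (hit_boundS q0 av).
rewrite /branching lerD2l lerN2 exprS mulrCA [leRHS]mulrC.
have -> : (1 - delta) * (1 - b * delta) ^+ j = 1 - q by rewrite /q subKr.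
by rewrite ler_pM ?subr_ge0 // ?lerD2l ?lerN2 ?ler_wpM2l // ?(ltW b0) // -[leRHS]mulr1 ler_pM
    // ltW.
Qed.

End Tent.
End Target.

Lemma bernoulli (h : R) n : 0 <= h -> 1 + n%:R * h <= (1 + h) ^+ n.
Proof.
move=> h0; elim: n => [|n IH]; first by rewrite mul0r addr0 expr0.
rewrite exprS; apply: le_trans (ler_wpM2l _ IH); last by rewrite addr_ge0.
have : 0 <= n%:R * h * h by rewrite !mulr_ge0.
by rewrite -[n.+1]add1n natrD; move: (n%:R : R) => N; lra.
Qed.

Lemma expr_unbounded (h M : R) : 0 < h -> exists n, M <= (1 + h) ^+ n.
Proof.
move=> h0; exists (Num.trunc (`|M| / h)).+1; apply: le_trans (bernoulli _ (ltW h0)).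
have : `|M| / h < (Num.trunc (`|M| / h)).+1%:R by apply: truncnS_gt; rewrite num_real.
rewrite ltr_pdivrMr // => /ltW H; apply: le_trans (ler_norm M) _; apply: le_trans H _.
by rewrite lerDr.
Qed.

(** The cap one half of [hit_bound_growth] times the lower bound of [bump_center]. *)
Definition success : R := 2^-1 ^+ d.+1.

(** Three phases, each linear in [T]: spreading over the support of [bump], growth from at least
    [c1 ^ T] to a constant, and [T] steps of saturation. *)
Lemma hit_bound_linear (c0 : R) : 0 < c0 -> c0 <= 1 ->
  exists K : nat, forall (T : nat) (x0 : 'rV[int]_d) (r : R),
    (0 < T)%N -> (nrm x0 <= 2 * T)%N -> c0 ^+ T <= r -> r <= 1 ->
    exists2 n, (n <= K * T)%N & 1 - (1 - b * success) ^+ T <= hit_bound b x0 r n 0.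
Proof.
(* This choice gives [D^-1 <= b / 8], enough for [Dlarge] because [b <= 1]. *)
move=> c00 c01; pose rho := (Num.trunc (8 / b)).+1.
have rho_gt : 8 / b < rho%:R by apply: truncnS_gt; rewrite num_real.
pose n1 := (d * (6 * rho))%N; pose c1 := c0 * deg^-1 ^+ n1.
have c1_gt0 : 0 < c1 by rewrite mulr_gt0 // exprn_gt0 // invr_gt0 deg_gt0.
have b4 : 0 < b / 4 by rewrite divr_gt0.
have [k hk] := expr_unbounded c1^-1 b4.
exists (n1 + k + 2)%N => T x0 r T0 x0T cr r1.
have r0 : 0 <= r by apply: le_trans cr; rewrite exprn_ge0 // ltW.
(* The factor 6 keeps the walk from the origin in the central ball during saturation, as
   [nrm x0 + T] is at most [3 * T]. The support of [bump] has radius [n0]. *)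
pose D := (6 * rho * T)%N; pose n0 := (d * D)%N.
have D0 : (0 < D)%N by rewrite !muln_gt0.
have n0E : n0 = (n1 * T)%N by rewrite /n0 /D /n1 !mulnA.
(* One extra step, if needed, corrects the parity. *)
pose s := odd (nrm x0) (+) odd (n0 + k * T + T); pose J := (k * T + s)%N.
have par : odd (nrm (0 - x0)) = odd (n0 + J + T).
  rewrite sub0r nrmN /J addnA addnAC [RHS]oddD oddb /s.
  by case: (odd (nrm x0)); case: (odd _).
have Dlarge : 1 + b / 4 <= (1 + b / 2) * (1 - D%:R^-1).
  have : (D%:R^-1 : R) <= b / 8.
    rewrite -[b / 8]invrK lef_pV2 ?posrE ?ltr0n ?invr_gt0 ?divr_gt0 // invf_div.
    apply: le_trans (ltW rho_gt) _; rewrite ler_nat /D -mulnA mulnCA leq_pmulr //.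
    by rewrite muln_gt0.
  have : 0 <= (D%:R^-1 : R) by rewrite invr_ge0.
  move: (D%:R^-1 : R) => t t0 tb; have : 0 <= t * (1 - b) by rewrite mulr_ge0 // subr_ge0.
  by lra.
pose c := r * deg^-1 ^+ n0.
have c_ge0 : 0 <= c by rewrite mulr_ge0 // exprn_ge0 // invr_ge0.
have start y : odd (nrm (y - x0)) = odd n0 -> c * bump x0 D y <= hit_bound b x0 r n0 y.
  move=> py; have [yn|yn] := leqP (nrm (y - x0)) n0.
    apply: le_trans (hit_bound_spread _ _ yn py) => //.
    by rewrite ler_piMr // bump_le1.
  by rewrite bump_support // mulr0; have /andP[] := hit_bound_itv x0 r0 r1 n0 y.
have big : 1 <= c * (1 + b / 4) ^+ J.
  have g1 : 1 <= 1 + b / 4 by rewrite lerDl ltW.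
  apply: le_trans (_ : (c1 * (1 + b / 4) ^+ k) ^+ T <= _).
    by rewrite exprn_ege1 // mulrC -ler_pdivrMr // div1r.
  have gk : 0 <= (1 + b / 4) ^+ (k * T) by rewrite exprn_ge0 // (le_trans ler01).
  rewrite exprMn -exprM /J exprD mulrA; apply: le_trans (_ : c * (1 + b / 4) ^+ (k * T) <= _).
    by rewrite ler_wpM2r // /c1 /c n0E exprMn -exprM ler_wpM2r //.
  by rewrite ler_peMr ?exprn_ege1 // mulr_ge0.
have half y : (2 * nrm (y - x0)%R <= D)%N -> odd (nrm (y - x0)) = odd (n0 + J) ->
    success <= hit_bound b x0 r (n0 + J) y.
  move=> yD py; apply: le_trans (hit_bound_growth r0 r1 D0 Dlarge c_ge0 start py).
  rewrite /success exprS (min_idPl _); last by apply: le_trans big; lra.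
  by rewrite ler_wpM2l ?invr_ge0 // bump_center.
have s01 : 0 <= success <= 1.
  by rewrite /success exprn_ge0 ?invr_ge0 // exprn_ile1 ?invr_ge0 // invf_le1 ?ler1n.
exists (n0 + J + T)%N.
  by rewrite n0E /J; rewrite !mulnDl; have := leq_b1 s;
      move: (nat_of_bool s) (n1 * T)%N (k * T)%N => sb u v; clear -T0; lia.
apply: le_trans (hit_bound_saturate (D := D) r0 r1 s01 half _ par).
  rewrite lerD2l lerN2 ler_piMl ?gerBl; first by [].
  - rewrite exprn_ge0 // subr_ge0; have /andP[s0 s1] := s01.
    by apply: le_trans s1; rewrite ler_piMl.
  - by have /andP[] := s01.
rewrite sub0r nrmN; apply: leq_trans (_ : 6 * T <= _)%N; first by move: (nrm x0) x0T => u uT;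
    clear -uT; lia.
by rewrite /D -mulnA leq_mul2l /= leq_pmull.
Qed.

End HitBound.

(** * Plans that display three words at one site *)

Section Stars.
Variable d : nat.
Implicit Types p q : seq (dir d).

Definition follow p (s : plan d) : plan d := foldr (@Step d) s p.

(* Seen from the site [y] of the branching particle, its ancestors come from the
   end of [p] and its descendants follow [q1] and [q2]. *)
Definition star p q1 q2 : plan d :=
  follow (rpath p)
    (if (q1, q2) is (e :: q1', f :: q2') then Fork e (follow q1' Done) f (follow q2' Done)
     else Done).

Lemma weight_follow (R : realType) (b : R) p s :
  weight b (follow p s) = (2 * d)%:R^-1 ^+ size p * weight b s.
Proof. by elim: p => [|e p IH] /=; rewrite ?mul1r // IH exprS mulrA. Qed.

Lemma weight_star (R : realType) (b : R) L p q1 q2 : (0 < L)%N ->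
  size p = L -> size q1 = L -> size q2 = L ->
  weight b (star p q1 q2) = b * ((2 * d)%:R^-1 ^+ 3) ^+ L.
Proof.
case: L q1 q2 => // L [|e q1] // [|f q2] // _ sp [s1] [s2].
rewrite /star !weight_follow /= !weight_follow size_rpath sp s1 s2 !mulr1 -!exprS.
by rewrite -exprM mulrCA -!exprD; congr (_ * _ ^+ _); lia.
Qed.

End Stars.

(** [K] is fixed before the probability space, because the time scales depend on it and one
    reconstruction must serve all realizations. The hitting time [n] varies with the site and the
    paths, by parity at least. *)
Lemma unseen_le (R : realType) (d : nat) (b : R) :
  (0 < d)%N -> 0 < b -> b <= 1 ->
  exists K : nat, forall (kappa : nat) (disp : measure_display)
    (Omega : measurableType disp) (P : probability Omega R)
    (xi : Omega -> scenery d kappa) (split : Omega -> particle -> bool)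
    (jump : Omega -> particle -> site d),
  scenery_and_BRW P b xi split jump ->
  forall T L : nat, (0 < L)%N -> (L <= T)%N ->
  exists N : Omega -> Prop, [/\ event measurable N,
    pr P N <= ((T + T).+1 ^ d * ((d * 2) ^ L) ^ 3)%:R * (1 - b * success R d) ^+ T
  & forall w, ~ N w -> forall (y : 'rV[int]_d) p q1 q2, (nrm y <= T)%N ->
      size p = L -> size q1 = L -> size q2 = L ->
      exists2 n, (n <= K * T)%N & hits (split w) (jump w) (pos y p) (star p q1 q2) n [::] 0].
Proof.
move=> d0 b0 b1; pose c0 : R := b * (2 * d)%:R^-1 ^+ 3.
have deg1 : ((2 * d)%:R^-1 ^+ 3 : R) <= 1.
  by rewrite exprn_ile1 ?invr_ge0 // invf_le1 ?ltr0n ?muln_gt0 // ler1n muln_gt0.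
have deg_pos : 0 < ((2 * d)%:R^-1 ^+ 3 : R).
  by rewrite exprn_gt0 // invr_gt0 ltr0n muln_gt0.
have c00 : 0 < c0 by rewrite mulr_gt0.
have c01 : c0 <= 1 by rewrite /c0 mulr_ile1 // ltW.
have [K hK] := hit_bound_linear d0 b0 b1 c00 c01.
exists K => kappa disp Omega P xi split jump model T L L0 LT.
have T0 : (0 < T)%N by exact: leq_trans LT.
pose A : Type := ('rV[int]_d * (L.-tuple (dir d) * (L.-tuple (dir d) * L.-tuple (dir d))))%type.
pose plan_of (a : A) := star a.2.1 a.2.2.1 a.2.2.2.
pose start (a : A) := pos a.1 a.2.1.
have ex (a : A) : exists n, (nrm a.1 <= T)%N -> (n <= K * T)%N /\
    1 - (1 - b * success R d) ^+ T <= hit_bound b (start a) (weight b (plan_of a)) n 0.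
  have [yT|] := leqP (nrm a.1) T; last by exists 0%N.
  have w_eq : weight b (plan_of a) = b * ((2 * d)%:R^-1 ^+ 3) ^+ L.
    by rewrite (weight_star b L0) ?size_tuple.
  have [||||n nK hn] := hK T (start a) (weight b (plan_of a)) => //.
  - by rewrite (leq_trans (nrm_pos0 _ _)) // size_tuple mul2n -addnn leq_add.
  (* As [L <= T] and both factors are at most 1, the weight is at least [c0 ^ T]. *)
  - rewrite w_eq /c0 exprMn; have [bge0 dge0] := (ltW b0, ltW deg_pos).
    by apply: ler_pM; rewrite ?exprn_ge0 ?ler_iXnr ?ler_wiXn2l.
  - have [bge0 dge0] := (ltW b0, ltW deg_pos).
    by rewrite w_eq; apply: mulr_ile1 => //; first [exact: exprn_ge0|exact: exprn_ile1].
  by exists n.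
have [n hn] := choice ex.
pose s : seq A := [seq (y, v) | y <- cube d T, v <- enum {: L.-tuple (dir d) * (L.-tuple (dir
    d) * L.-tuple (dir d))}].
pose Q (a : A) w := (nrm a.1 <= T)%N /\
  ~ hits (split w) (jump w) (start a) (plan_of a) (n a) [::] 0.
have mhit (a : A) : event measurable (hit split jump (start a) (plan_of a) (n a) [::] 0).
  by apply: (mevent model); exact: (event_hit model).
exists (fun w => exists2 a, a \in s & Q a w); split.
- apply: event_has => a _; apply: (event_and (sigma_algebra_measurable _)).
    exact: (event_const (sigma_algebra_measurable _)).
  exact: (event_not (sigma_algebra_measurable _) (mhit a)).
- have -> : ((T + T).+1 ^ d * ((d * 2) ^ L) ^ 3)%N = size s.
    rewrite size_allpairs -cardE size_cube !card_prod card_tuple card_prod card_ord card_bool.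
    by rewrite 2![in LHS](expnS ((d * 2) ^ L)) expn1.
  apply: pr_has_le => a _.
    apply: (event_and (sigma_algebra_measurable _)).
      exact: (event_const (sigma_algebra_measurable _)).
    exact: (event_not (sigma_algebra_measurable _) (mhit a)).
  have [yT|yT] := leqP (nrm a.1) T; last first.
    rewrite pr_none => [|w [/= yT']]; last by rewrite leqNgt yT in yT'.
    by rewrite exprn_ge0 // subr_ge0 mulr_ile1 ?(ltW b0) ?exprn_ge0 ?exprn_ile1 ?invr_ge0 //
        invf_le1 ?ler1n.
  have [_ h] := hn a yT.
  rewrite (pr_ext P (Q' := fun w => ~ hit split jump (start a) (plan_of a) (n a) [::] 0 w));
      last first.
    by move=> w; split=> [[]|].
  rewrite pr_not // lerBlDr -lerBlDl; apply: le_trans h _.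
  by apply: (pr_hit_ge model) => //; exact: ltW.
move=> w nN y p q1 q2 yT /eqP sp /eqP s1 /eqP s2.
pose a : A := (y, (Tuple sp, (Tuple s1, Tuple s2))).
have [nK _] := hn a yT; exists (n a) => //; apply: contrapT => nh; apply: nN.
exists a; last by split.
by apply: allpairs_f; [exact: mem_cube|exact: mem_enum].
Qed.

(** * Words observed in the colored tree *)

Section Seen.
Variable kappa : nat.
Implicit Types (chi : colored_tree kappa) (u v : particle) (a b c : seq 'I_kappa).

Fixpoint lineage chi v : seq (option 'I_kappa) :=
  chi v :: if v is _ :: u then lineage chi u else [::].

(** The empty word is excluded since it would match at labels outside the tree, while no path reads
    it. *)
Definition read_up chi v a := (0 < size a)%N /\ take (size a) (lineage chi v) = map Some a.

Definition read_down chi t v b := exists u,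
  [/\ (size (u ++ v) <= t)%N, size b = (size u).+1
    & take (size b) (lineage chi (u ++ v)) = map Some (rev b)].

Definition seen chi t a b c :=
  exists v, [/\ read_up chi v a, read_down chi t v b & read_down chi t v c].

Let sigma_tree : sigma_algebra setT (@colored_tree_sigma kappa).
Proof. exact: sigma_algebra_coordinate. Qed.

Lemma event_lineage v n s :
  event (@colored_tree_sigma kappa) (fun chi => take n (lineage chi v) = s).
Proof.
have ev_color v' (Q : option 'I_kappa -> Prop) : event (@colored_tree_sigma kappa) (fun chi =>
    Q (chi v')).
  exact: (@event_coordinate _ _ _ (fun (v : particle) (chi : colored_tree kappa) => chi v) v' Q).
elim: v n s => [|i v IH] [|n] s /=.
- exact: event_const.
- exact: (ev_color [::] (fun o => [:: o] = s)).
- exact: event_const.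
apply: (@event_ext _ (@colored_tree_sigma kappa) (fun chi => chi (i :: v) :: behead s = s /\
    take n (lineage chi v) = behead s)).
  by move=> chi; split=> [[{2}<- ->] //|<-].
apply: (event_and sigma_tree) => //; exact: (ev_color (i :: v) (fun o => o :: behead s = s)).
Qed.

Lemma event_seen t a b c : event (@colored_tree_sigma kappa) (fun chi => seen chi t a b c).
Proof.
have down v b' : event (@colored_tree_sigma kappa) (fun chi => read_down chi t v b').
  apply: (event_exists sigma_tree) => u.
  apply: (@event_ext _ (@colored_tree_sigma kappa) (fun chi => ((size (u ++ v) <= t)%N /\ size
      b' = (size u).+1) /\
      take (size b') (lineage chi (u ++ v)) = map Some (rev b'))).
    by move=> chi; split=> [[[]]|[]].
  by apply: (event_and sigma_tree); [exact: (event_const sigma_tree)|exact: event_lineage].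
apply: (event_exists sigma_tree) => v.
apply: (@event_ext _ (@colored_tree_sigma kappa) (fun chi => read_up chi v a /\ (read_down chi
    t v b /\ read_down chi t v c))).
  by move=> chi; split=> [[? []]|[]].
apply: (event_and sigma_tree); last exact: (event_and sigma_tree).
by apply: (event_and sigma_tree); [exact: (event_const sigma_tree)|exact: event_lineage].
Qed.

Section Observation.
Variables (d : nat) (xi : scenery d kappa) (split : particle -> bool)
  (jump : particle -> site d).
Hypothesis nearest : forall v, exists e, jump v = vec e.
Notation chi := (observation xi split jump).

(** Reversed jumps turn a lineage into the trace of a lattice path. Labels outside the tree show
    [None], so matching a nonempty word of colors forces the particle to exist. *)
Lemma seen_observation_sound : sound (seen chi) xi.
Proof.
have [dirs dirsE] := choice nearest.
pose back := fix back v := if v is _ :: u then opp (dirs v) :: back u else [::].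
have pos_back u v : pos (position jump (u ++ v)) (take (size u) (back (u ++ v))) = position jump v.
  by elim: u => [|i u IH] /=; rewrite ?take0 // dirsE vec_opp addrK.
have lineageE v : in_tree split v -> lineage chi v = map Some (trace xi (position jump v) (back v)).
  elim: v => [|i v IH] //= /andP[tv sv]; rewrite /observed_color /= tv sv /=.
  by rewrite dirsE vec_opp addrK IH.
have in_treeP v n o s : take n (lineage chi v) = Some o :: s -> in_tree split v.
  by case: v n => [|i v] [|n] //= []; rewrite /observed_color /=; case: ifP.
have nrm_position v : (nrm (position jump v) <= size v)%N.
  elim: v => [|i v IH] /=; first by rewrite nrm0.
  by rewrite dirsE (leq_trans (nrmD _ _)) // nrm_vec addn1 ltnS.
have down t v b : read_down chi t v b -> reads xi (position jump v) b /\ (nrm (position jump v)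
    <= t)%N.
  move=> [u [ut sb E]]; split; last first.
    by apply: leq_trans (nrm_position v) (leq_trans _ ut); rewrite size_cat leq_addl.
  have tu : in_tree split (u ++ v).
    move: E; have : rev b != [::] by rewrite -size_eq0 size_rev sb.
    by case: (rev b) => // o s _ /in_treeP.
  move: E; rewrite (lineageE _ tu) -map_take sb take_trace => /inj_map E.
  exists (rpath (take (size u) (back (u ++ v)))).
  by rewrite -(pos_back u v) -rev_trace E ?revK // => ? ? [].
move=> t a b c [v [[a0 Ea] /down[rb vt] /down[rc _]]].
exists (position jump v); split=> //.
have tv : in_tree split v by move: Ea a0; case: a => // o s /in_treeP.
move: Ea a0; rewrite (lineageE _ tv) -map_take => /inj_map E.
case: a E => // o s E _; exists (take (size s) (back v)).
by rewrite -take_trace -E // => ? ? [].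
Qed.

Lemma take_lineage_cat u v :
  take (size u).+1 (lineage chi (u ++ v)) = rcons (take (size u) (lineage chi (u ++ v))) (chi v).
Proof.
elim: u => [|i u IH] /=; last by rewrite IH.
by case: v => [|j v] /=; rewrite ?take0.
Qed.

Lemma realized_follow v p s : in_tree split v -> realized split jump v (follow p s) ->
  exists u, [/\ size u = size p, in_tree split (u ++ v),
    position jump (u ++ v) = pos (position jump v) p, realized split jump (u ++ v) s
    & take (size p).+1 (lineage chi (u ++ v)) = map Some (rev (trace xi (position jump v) p))].
Proof.
elim: p v => [|e p IH] v tv /=.
  move=> r; exists [::]; split=> //=.
  by case: v tv {r} => [|i v] //= tv; rewrite take0 /observed_color /= tv.
case=> je /IH[]; first by rewrite /= tv.
move=> u [su tu pu ru Eu]; exists (rcons u false); rewrite cat_rcons; split=> //.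
- by rewrite size_rcons su.
- by rewrite pu /= je.
rewrite -cat_rcons -su -(size_rcons u false) take_lineage_cat size_rcons su cat_rcons Eu /=.
by rewrite je rev_cons map_rcons /= /observed_color tv.
Qed.

Lemma read_down_child v i e q r t : in_tree split (i :: v) ->
  jump (i :: v) = vec e -> realized split jump (i :: v) (follow q Done) ->
  (size q + (size v).+1 <= t)%N -> forall p, e :: q = p ++ r ->
  read_down chi t v (trace xi (position jump v) p).
Proof.
move=> ta je rq st [|f p] /=.
  have tv : in_tree split v by move: ta => /= /andP[].
  move=> _; exists [::]; split=> //=; first by lia.
  by case: v tv {ta je rq st} => [|j v] //= tv; rewrite take0 /observed_color /= tv.
case=> <- qE; move: rq st; rewrite qE /follow foldr_cat.
move=> /(realized_follow ta)[u [su tu _ _ Eu]] st.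
exists (rcons u i); rewrite cat_rcons; split.
- by move: st; rewrite !size_cat /= su; lia.
- by rewrite /= size_trace size_rcons su.
rewrite /= size_trace -su -(size_rcons u i) -cat_rcons take_lineage_cat size_rcons su cat_rcons Eu.
rewrite rev_cons map_rcons /= je /observed_color /=.
by move: ta => /= /andP[-> _].
Qed.

Lemma hits_position x0 s n v : in_tree split v ->
  hits split jump x0 s n v (position jump v) ->
  exists u, [/\ size u = (n + size v)%N, in_tree split u, position jump u = x0
              & realized split jump u s].
Proof.
elim: n v => [|n IH] v tv /=; first by case=> <- ?; exists v.
have next i : in_tree split (i :: v) ->
    hits split jump x0 s n (i :: v) (position jump v + jump (i :: v)) ->
    exists u, [/\ size u = (n.+1 + size v)%N, in_tree split u, position jump u = x0 & realized
        split jump u s].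
  by move=> ta /(IH (i :: v) ta)[u [su ? ? ?]]; exists u; rewrite su addSnnS.
by case=> [|[sv]]; apply: next => /=; rewrite tv ?sv.
Qed.

(** Paths are padded to length [L], the only length for which stars are known to occur. The time
    adds up reaching the tip of the star, walking to [y], and descending from it. *)
Lemma seen_observation_complete (K T L t t' : nat) : (0 < d)%N -> (0 < L)%N -> (t <= T)%N ->
  (forall (y : 'rV[int]_d) p q1 q2, (nrm y <= T)%N ->
     size p = L -> size q1 = L -> size q2 = L ->
     exists2 n, (n <= K * T)%N & hits split jump (pos y p) (star p q1 q2) n [::] 0) ->
  (K * T + L + L <= t')%N ->
  complete (seen chi) xi L t t'.
Proof.
move=> d0 L0 tT H ht' y p1 p2 p3 yt s1 s2 s3.
have e0 : dir d := (Ordinal d0, true).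
pose pad (p : seq (dir d)) := nseq (L - size p) e0.
have size_pad p : (size p <= L)%N -> size (p ++ pad p) = L.
  by move=> ?; rewrite size_cat size_nseq subnKC.
have [n nK] := H y _ _ _ (leq_trans yt tT) (size_pad _ s1) (size_pad _ s2) (size_pad _ s3).
rewrite -[0](erefl : position jump [::] = 0) => /(hits_position (isT : in_tree split [::])).
move=> [v0 [sv0 tv0 pv0]].
(* Reversal puts the padding first: it leads from [v0] to [v1], and the steps from [v1] to [v]
   retrace exactly [p1]. *)
rewrite /star /rpath map_cat rev_cat /follow foldr_cat.
move=> /(realized_follow tv0)[v1 [sv1 tv1 pv1 + _]].
move=> /(realized_follow tv1)[v2 [sv2 tv2 pv2 rv2 Ev2]].
set v := v2 ++ v1 ++ v0 in tv2 pv2 rv2 Ev2.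
have pv1' : position jump (v1 ++ v0) = pos y p1.
  by rewrite pv1 pv0 pos_cat; exact: pos_rpath.
have pv : position jump v = y by rewrite pv2 pv1' pos_rpath.
have up : read_up chi v (trace xi y p1).
  split; first by rewrite size_trace.
  have -> : trace xi y p1 = rev (trace xi (position jump (v1 ++ v0)) (rpath p1)).
    by rewrite pv1' -rev_trace revK.
  by rewrite size_rev size_trace; exact: Ev2.
have szv : size v = (n + L)%N.
  rewrite /v !size_cat sv2 sv1 sv0 !size_rev !size_map -(size_pad _ s1) size_cat addn0.
  by rewrite addnA addnC.
exists v; split=> //; rewrite -pv.
  move: rv2; case E2 : (p2 ++ pad p2) => [|e q1] //.
    by have := size_pad _ s2; rewrite E2 /= => L0'; rewrite -L0' in L0.
  case E3 : (p3 ++ pad p3) => [|f q2] //.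
    by have := size_pad _ s3; rewrite E3 /= => L0'; rewrite -L0' in L0.
  move=> [sv [[je re] _]]; apply: (read_down_child _ je re _ (esym E2)).
    by rewrite /= tv2.
  have := size_pad _ s2; rewrite E2 /= szv => sq.
  by apply: leq_trans ht'; move: sq nK; lia.
move: rv2; case E2 : (p2 ++ pad p2) => [|e q1] //.
  by have := size_pad _ s2; rewrite E2 /= => L0'; rewrite -L0' in L0.
case E3 : (p3 ++ pad p3) => [|f q2] //.
  by have := size_pad _ s3; rewrite E3 /= => L0'; rewrite -L0' in L0.
move=> [sv [_ [jf rf]]]; apply: (read_down_child _ jf rf _ (esym E3)).
  by rewrite /= tv2 sv.
have := size_pad _ s3; rewrite E3 /= szv => sq.
by apply: leq_trans ht'; move: sq nK; lia.
Qed.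

End Observation.
End Seen.

(** * Assembling the scales *)

Section Scales.
Variable R : realType.

Lemma eventually_le_exp2 a : exists k1, forall k, (k1 <= k)%N -> (a * k.+1 <= 2 ^ k)%N.
Proof.
exists (4 * a)%N => k hk; have h1 := ltn_expl k./2 (isT : (1 < 2)%N).
have h2 := ltn_expl (k - k./2).-1 (isT : (1 < 2)%N).
have h3 : (k./2 <= k)%N by have := odd_double_half k; rewrite -mul2n; lia.
rewrite -[in leqRHS](subnKC h3) expnD.
apply: leq_trans (_ : k./2.+1 * (2 * a) <= _)%N.
  have := odd_double_half k; case: (odd k) => /=; rewrite -mul2n; nia.
apply: leq_mul => //; apply: leq_trans (_ : k - k./2 <= _)%N.
  have := odd_double_half k; case: (odd k) => /=; rewrite -mul2n; lia.
by case: (k - k./2)%N h2 => // j; rewrite /= expnS; have := expn_gt0 2 j; lia.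
Qed.

Lemma expr_small (q eps : R) : 0 <= q -> q < 1 -> 0 < eps -> exists2 n, (0 < n)%N & q ^+ n <= eps.
Proof.
move=> q0 q1 eps0; have [->|qn0] := eqVneq q 0.
  by exists 1%N; rewrite ?expr1 // ltW.
have qp : 0 < q by rewrite lt_neqAle eq_sym qn0.
have h0 : 0 < q^-1 - 1 by rewrite subr_gt0 invf_gt1.
have [n hn] := expr_unbounded eps^-1 h0.
exists n.+1 => //; apply: le_trans (_ : q ^+ n <= _).
  by rewrite exprS ler_piMl ?exprn_ge0 // ltW.
move: hn; rewrite addrCA subrr addr0 exprVn lef_pV2 ?posrE ?exprn_gt0 //.
Qed.

(** Half of the decay [4 ^ -k] pays for [A]; the rest is in the form whose series is summed in the
    Borel-Cantelli argument. *)
Lemma geometric_le (A : nat) (x : R) k : 0 <= x -> x <= 4^-1 -> (A <= 2 ^ k)%N ->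
  A%:R * x ^+ k <= 2 / (2 ^ k.+1)%:R.
Proof.
move=> x0 x4 Ak; apply: le_trans (_ : (2 ^ k)%:R * 4^-1 ^+ k <= _).
  by rewrite ler_pM ?exprn_ge0 ?ler_nat // lerXn2r ?nnegrE ?invr_ge0.
have -> : 4^-1 = 2^-1 * 2^-1 :> R by rewrite -invfM -natrM.
have n0 : (2 : R) != 0 by rewrite pnatr_eq0.
rewrite exprMn mulrA natrX -exprMn divff // expr1n mul1r.
by rewrite expnS natrM natrX invfM mulrA divff // mul1r exprVn.
Qed.

Variables (d kappa K : nat) (rho : R).
Hypotheses (d0 : (0 < d)%N) (hkappa : (2 * d < kappa)%N) (K2 : (1 < K)%N).
Hypotheses (rho0 : 0 <= rho) (rho1 : rho < 1).

Lemma scales : exists C k1, (0 < C)%N /\ forall k, (k1 <= k)%N ->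
  let m := (C * k)%N in
  [/\ ((m + m).+2 <= K ^ k)%N,
      ((K ^ k + K ^ k).+1 ^ d * ((d * 2) ^ (m + m).+1) ^ 3)%:R * rho ^+ (K ^ k) <= 2 / (2 ^ k.+1)%:R
    & ((((K ^ k.+3).+1 + m + ((K ^ k.+3).+1 + m)).+1 ^ d) ^ 2 * (d * 2) ^ m.+1)%:R *
        (kappa%:R^-1 : R) ^+ m
        <= 2 / (2 ^ k.+1)%:R].
Proof.
have K0 : (0 < K)%N by exact: ltnW.
have kappa0 : 0 < (kappa%:R : R) by rewrite ltr0n; lia.
pose q : R := (2 * d)%:R / kappa%:R.
have q0 : 0 <= q by rewrite divr_ge0.
have q1 : q < 1 by rewrite ltr_pdivrMr // mul1r ltr_nat.
have Kd0 : 0 < ((K ^ (d + d))%:R : R) by rewrite ltr0n expn_gt0 K0.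
(* Per unit of [k], the number of pairs of sites grows by [K ^ (d + d)] and [C] more steps gain
   [q ^ C]; a factor 4 is kept for summability. *)
have [C C0 hC] : exists2 C, (0 < C)%N & q ^+ C <= (4 * (K ^ (d + d))%:R)^-1.
  by apply: expr_small; rewrite ?invr_gt0 ?mulr_gt0.
pose B := (K ^ d * (2 * d) ^ (6 * C))%N.
have B0 : 0 < (B%:R : R) by rewrite ltr0n muln_gt0 !expn_gt0 K0 muln_gt0 d0.
(* [B] is the growth, per unit of [k], of the number of sites and triples of words; [s * k <= K ^ k]
   lets [rho ^ (K ^ k)] beat it. *)
have [s s0 hs] : exists2 s, (0 < s)%N & rho ^+ s <= (4 * B%:R)^-1.
  by apply: expr_small; rewrite ?invr_gt0 ?mulr_gt0.
(* The factors free of [k], from bounding the boxes by [K ^ k.+2] and [K ^ (k + 6)] and from the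
   extra step in the exponents; [2 ^ k] absorbs them. *)
pose A1 := (K ^ (d + d) * (2 * d) ^ 3)%N; pose A2 := (K ^ (12 * d) * (2 * d))%N.
have [k1 hk1] := eventually_le_exp2 (A1 + A2 + s + (C + C + 2)).
exists C, k1; split=> // k /hk1 hk m.
have K2k : (2 ^ k <= K ^ k)%N by case: (k) => // j; rewrite leq_exp2r.
have Kk0 : (0 < K ^ k)%N by rewrite expn_gt0 K0.
have hm : ((m + m).+2 <= K ^ k)%N by apply: leq_trans K2k; move: hk; rewrite /m; clear;
    rewrite !mulnDl !mulnS; lia.
have K4 (j : nat) : (4 * j <= K * (K * j))%N by rewrite mulnA leq_mul2r (leq_mul K2 K2) orbT.
have A1k : (A1 <= 2 ^ k)%N by move: hk; clear; rewrite !mulnDl !mulnS; lia.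
have A2k : (A2 <= 2 ^ k)%N by move: hk; clear; rewrite !mulnDl !mulnS; lia.
have sk : (s * k <= K ^ k)%N by apply: leq_trans K2k; move: hk; clear; rewrite !mulnDl !mulnS; lia.
split=> //.
- apply: le_trans (geometric_le (x := B%:R * rho ^+ s) _ _ A1k); last 2 first.
  + by rewrite mulr_ge0 // exprn_ge0.
  + by rewrite -ler_pdivlMl // -invfM mulrC.
  rewrite exprMn mulrA -natrX -natrM -exprM; apply: ler_pM => //; first by rewrite exprn_ge0.
    rewrite ler_nat; apply: leq_trans (_ : (K ^ k.+2) ^ d * ((d * 2) ^ (m + m).+1) ^ 3 <= _)%N.
      rewrite leq_mul2r leq_exp2r // orbC; apply/orP; left.
      by rewrite !expnS; have := K4 (K ^ k)%N; move: Kk0; clear; lia.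
    rewrite leq_eqVlt; apply/orP; left; apply/eqP.
    rewrite /A1 /B (mulnC d 2); move: (2 * d)%N => D.
    rewrite expnMn -!expnM mulnACA -!expnD; by congr (_ ^ _ * _ ^ _)%N; rewrite /m; clear; lia.
  by rewrite ler_wiXn2l // ltW.
apply: le_trans (geometric_le (x := (K ^ (d + d))%:R * q ^+ C) _ _ A2k); last 2 first.
- by rewrite mulr_ge0 // exprn_ge0.
- by rewrite -ler_pdivlMl // -invfM mulrC.
have -> : A2%:R * ((K ^ (d + d))%:R * q ^+ C) ^+ k =
    (A2 * (K ^ (d + d)) ^ k * (2 * d) ^ m)%:R * kappa%:R^-1 ^+ m.
  by rewrite exprMn -(exprM q) -/m /q exprMn (natrM _ (A2 * _)) (natrM _ A2) !natrX !mulrA.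
rewrite ler_wpM2r ?exprn_ge0 ?invr_ge0 // ler_nat.
apply: leq_trans (_ : ((K ^ (k + 6)) ^ d) ^ 2 * (d * 2) ^ m.+1 <= _)%N.
  rewrite leq_mul2r !leq_exp2r // orbC; apply/orP; left.
  have -> : (K ^ (k + 6) = K * (K * (K * K ^ k.+3)))%N by rewrite -!expnS; congr (_ ^ _)%N; lia.
  have := K4 (K ^ k.+3)%N; have := leq_mul (leqnn (K * (K * K ^ k.+3))%N) (ltnW K2).
  have : (K ^ k <= K ^ k.+3)%N by rewrite leq_exp2l //; lia.
  by move: (K ^ k.+3)%N (K ^ k)%N hm => u v hm; move: (K * (K * u))%N => z;
      rewrite (mulnC K z); lia.
rewrite leq_eqVlt; apply/orP; left; apply/eqP.
rewrite /A2 (mulnC d 2); move: (2 * d)%N => D; rewrite -!expnM expnS mulnA; congr (_ * _)%N.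
by rewrite mulnAC -expnD; congr (_ ^ _ * _)%N; clear; lia.
Qed.

End Scales.

(** * Locality and measurability of the tests *)

Section ValidEvents.
Variables (d : nat) (C : Type).

Lemma valid_local (Seen : nat -> seq C -> seq C -> seq C -> Prop) N r t1 t2 t3
    (D D' : 'rV[int]_d -> label C) (eta eta' : 'rV[int]_d -> C) :
  (forall x, (nrm x <= r)%N -> D x = D' x) ->
  (forall x, (nrm x <= r)%N -> eta x = eta' x) ->
  valid Seen N r t1 t2 t3 D eta -> valid Seen N r t1 t2 t3 D' eta'.
Proof.
move=> hD heta [h1 h2 h3 h4 h5 h6]; split.
- by move=> x xr; rewrite -hD //; exact: h1.
- by move=> x xr; rewrite -hD // -heta //; exact: h2.
- by move=> x xr; rewrite -hD //; exact: h3.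
- by move=> x xr; rewrite -hD //; exact: h4.
- by move=> x y xr yr; rewrite -!hD //; exact: h5.
- by move=> x y xr yr; rewrite -!hD //; exact: h6.
Qed.

End ValidEvents.

Lemma event_valid (d : nat) (C : countType) (T : Type) (S : set (set T))
    (sigmaS : sigma_algebra setT S) (Seen : T -> nat -> seq C -> seq C -> seq C -> Prop)
    N r t1 t2 t3 (D : 'rV[int]_d -> label C) (eta : 'rV[int]_d -> C) :
  (forall t a b c, event S (fun w => Seen w t a b c)) ->
  event S (fun w => valid (Seen w) N r t1 t2 t3 D eta).
Proof.
move=> mS; have ec := event_const sigmaS; have ei := event_imply sigmaS.
have ea := event_and sigmaS; have en := event_not sigmaS.
have ef (I : countType) := @event_forall _ _ sigmaS I.
have ex (I : countType) := @event_exists _ _ sigmaS I.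
have mb t l c : event S (fun w => branch (Seen w) N t l c) by exact: ea.
apply: (@event_ext _ S (fun w =>
  (((forall x, (nrm x <= r)%N -> size (D x).1 = N.+1 /\ size (D x).2 = N.+1) /\
  (forall x, (nrm x <= r)%N -> ohead (D x).1 = Some (eta x))) /\
  ((forall x, (nrm x <= r)%N -> exists c, branch (Seen w) N t1 (D x) c) /\
  (forall x, (nrm x <= r)%N -> forall c c',
    branch (Seen w) N t2 (D x) c -> branch (Seen w) N t2 (D x) c' -> Seen w t3 c c' c'))) /\
  ((forall x y, (nrm x <= r)%N -> (nrm y <= r)%N -> x <> y ->
    exists c c', (branch (Seen w) N t1 (D x) c /\ branch (Seen w) N t1 (D y) c') /\ ~ Seen w t2
        c c' c') /\
  (forall x y, (nrm x <= r)%N -> (nrm y <= r)%N ->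
    nrm (x - y) = 1%N -> forall c c',
    branch (Seen w) N t2 (D x) c -> branch (Seen w) N t2 (D y) c' ->
    Seen w t3 c (take 1 c ++ c') (take 1 c ++ c'))))).
  move=> w; split=> [[[[h1 h2] [h3 h4]] [h5 h6]]|[h1 h2 h3 h4 h5 h6]].
    by split=> // x y xr yr xy; have [c [c' [[? ?] ?]]] := h5 x y xr yr xy; exists c, c'.
  by do !split=> //; move=> x y xr yr xy; have [c [c' [? ? ?]]] := h5 x y xr yr xy; exists c, c'.
apply: (ea); first apply: (ea); last apply: (ea).
- exact: (ec).
- apply: (ea); first by apply: (ef) => x; apply: (ei) => //; exact: (ex).
  by apply: (ef) => x; apply: (ei) => //; apply: (ef) => c; apply: (ef) => c';
      do 2 apply: (ei) => //.
- apply: (ef) => x; apply: (ef) => y; do 3 apply: (ei) => //.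
  by apply: (ex) => c; apply: (ex) => c'; apply: (ea); [exact: (ea)|exact: (en)].
- apply: (ef) => x; apply: (ef) => y; do 3 apply: (ei) => //.
  by apply: (ef) => c; apply: (ef) => c'; do 2 apply: (ei) => //.
Qed.

(** * Two placements of one coloring coincide *)

Section Uniqueness.
Variable d : nat.

Lemma dot1_vec (x : 'rV[int]_d) : dot x x = 1 -> exists e, x = vec e.
Proof.
move=> h; apply: nrm1_vec.
have le : (nrm x)%:Z <= dot x x.
  rewrite dotE /nrm -natz natr_sum; apply: ler_sum => i _.
  by rewrite natz; move: (x ord0 i) => a; nia.
have : nrm x <> 0%N by move=> /nrm_eq0 x0; move: h; rewrite x0 dotE big1 // => i _;
    rewrite mxE mul0r.
by move: le; rewrite h; move: (nrm x) => n; lia.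
Qed.

(** Along each axis both maps place the same color word on a straight path, so [localizes] makes the
    midpoints agree, and these determine the map. *)
Lemma affine_uniq (C : Type) (xi : 'rV[int]_d -> C) m T (A A' : 'rV[int]_d * 'M[int]_d) :
  (0 < d)%N -> (0 < m)%N -> A.2 *m A.2^T = 1%:M -> A'.2 *m A'.2^T = 1%:M ->
  (nrm (affine A 0) <= T)%N -> (nrm (affine A' 0) <= T)%N -> localizes xi T m ->
  (forall x, (nrm x <= m + m)%N -> xi (affine A x) = xi (affine A' x)) -> A = A'.
Proof.
move=> d0 m0 MM MM' AT AT' loc E; apply: (affine_inj d0 m0) => e.
have unit (B : 'M[int]_d) : B *m B^T = 1%:M -> exists f, vec e *m B = vec f.
  move=> BB; apply: dot1_vec; rewrite dot_mulmx // dotE dot_vec !eqxx //.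
have [f fE] := unit _ MM; have [f' fE'] := unit _ MM'.
have along B g : vec e *m B.2 = vec g -> forall n, affine B (vec e *+ n) = affine B 0 + vec g *+ n.
  move=> gE n; rewrite /affine mul0mx addr0 -gE.
  by congr (_ + _); elim: n => [|n IH]; rewrite ?mulr0n ?mul0mx // !mulrS mulmxDl IH.
have trE B g : vec e *m B.2 = vec g -> forall n,
    trace xi (affine B 0) (nseq n g) = mkseq (fun i => xi (affine B (vec e *+ i))) n.+1.
  move=> gE n; apply: (@eq_from_nth _ (xi 0)); first by rewrite size_trace size_nseq size_mkseq.
  move=> i; rewrite size_trace size_nseq => ip.
  by rewrite nth_trace ?size_nseq // nth_mkseq // take_nseq // pos_nseq (along _ _ gE).
have := loc (affine A 0) (affine A' 0) f (nseq (m + m) f') AT AT' (size_nseq _ _).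
rewrite (trE _ _ fE) (trE _ _ fE') take_nseq ?leq_addr // pos_nseq.
rewrite (along _ _ fE) (along _ _ fE') => H; apply/esym/H.
apply/eq_in_map => i; rewrite mem_iota add0n ltnS => /andP[_ im]; apply/esym/E.
by have := nrm_push i (u := 0) (e := e); rewrite co0 lexx add0r nrm0 add0n => ->.
Qed.

End Uniqueness.

(** * Exceptional null sets and measurability of success *)

Section AlmostSure.
Context {disp : measure_display} {Omega : measurableType disp} {R : realType}.
Variable P : probability Omega R.

Lemma pr_borel_cantelli (B : nat -> Omega -> Prop) k1 :
  (forall k, event measurable (B k)) ->
  (forall k, (k1 <= k)%N -> pr P (B k) <= 4 / (2 ^ k.+1)%:R) ->
  P.-negligible [set w | forall k0, exists k, (k0 <= k)%N /\ B k w].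
Proof.
move=> mB hB; pose F k := [set w | (k1 <= k)%N /\ B k w].
have mF k : measurable (F k).
  by apply: (event_and (sigma_algebra_measurable _) _ (mB k));
      exact: (event_const (sigma_algebra_measurable _)).
have F0 : P (lim_sup_set F) = 0.
  apply: lim_sup_set_cvg0 => //.
  apply: (@le_lt_trans _ _ (\sum_(0 <= k <oo) (4 / (2 ^ k.+1)%:R)%:E)%E); last first.
    by apply: (le_lt_trans (epsilon_trick0 xpredT _)); rewrite ?ltry.
  apply: lee_nneseries => // k _;
      apply: le_trans (_ : (pr P (fun w => (k1 <= k)%N /\ B k w))%:E <= _)%E.
    by rewrite -prE //; exact: mF.
  rewrite lee_fin.
  have [/hB kk|kk] : (k1 <= k)%N \/ ~ (k1 <= k)%N by case: (k1 <= k)%N; [left|right].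
    by apply: le_trans kk; apply: pr_mono => [|//|w [] //]; exact: mF.
  by rewrite pr_none ?divr_ge0 // => w [].
exists (lim_sup_set F); split=> //.
  by apply: bigcapT_measurable => n; apply: bigcup_measurable => k _; exact: mF.
move=> w h n _; have [k [nk Bk]] := h (maxn n k1).
exists k; first exact: leq_trans (leq_maxl _ _) nk.
by split=> //; exact: leq_trans (leq_maxr _ _) nk.
Qed.

Variables (d kappa : nat) (b : R).
Variables (xi : Omega -> scenery d kappa) (split : Omega -> particle -> bool)
  (jump : Omega -> particle -> site d).
Hypothesis model : scenery_and_BRW P b xi split jump.

Let sigma_m : sigma_algebra setT (measurable : set (set Omega)) := sigma_algebra_measurable _.

(** The unit vectors already carry total mass one, and there are countably many labels. *)
Lemma negligible_not_nearest : (0 < d)%N ->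
  P.-negligible [set w | ~ forall v, exists e, jump w v = vec e].
Proof.
move=> d0.
have mE v : event measurable (fun w => exists e, jump w v = vec e).
  apply: (event_exists sigma_m) => e; apply: (mevent model (J := setT)).
  exact: (@event_jump _ _ _ _ xi split jump setT v (fun u => u = vec e)).
have prE1 v : pr P (fun w => ~ exists e, jump w v = vec e) = 0.
  apply/eqP; rewrite eq_le pr_ge0 andbT pr_not // subr_le0.
  apply: le_trans (sum_pr_jump_le model v (mE v)).
  rewrite (eq_bigr (fun=> (2 * d)%:R^-1)) => [|e _].
    by rewrite sum_dir_const mulfV // pnatr_eq0 -lt0n muln_gt0.
  by rewrite -(pr_jump model v e); apply: pr_ext => w; split=> [[]|h] //; split=> //; exists e.
pose G n := [set w | if @choice.unpickle (seq bool) n is Some v then ~ exists e, jump w v = vec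
    e else False].
apply: (negligibleS (A := \bigcup_n G n)).
  move=> w /existsNP[v hv]; exists (choice.pickle (v : seq bool)) => //.
  by rewrite /G /mkset choice.pickleK.
apply: negligible_bigcup => n; rewrite /G; case: choice.unpickle => [v|]; last first.
  exact: negligible_set0.
exists [set w | ~ exists e, jump w v = vec e]; split=> //; first exact: (event_not sigma_m).
by rewrite [LHS](prE P (event_not sigma_m (mE v))) prE1.
Qed.

Lemma event_observation (B : set (colored_tree kappa)) : colored_tree_sigma B ->
  event measurable (fun w => B (observation (xi w) (split w) (jump w))).
Proof.
apply: (sigma_algebra_preimage_sub (f := fun w => observation (xi w) (split w) (jump w)) sigma_m).
move=> A [v _ [D _ <-]]; rewrite setTI.
have ms u : event measurable (fun w => split w u).
  by apply: (mevent model (J := setT)); exact: event_split.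
have mj u x : event measurable (fun w => jump w u = x).
  by apply: (mevent model (J := setT));
      exact: (@event_jump _ _ _ _ xi split jump setT u (fun y => y = x)).
have mx x c : event measurable (fun w => xi w x = c).
  by apply: (mevent model (J := setT));
      exact: (@event_xi _ _ _ _ xi split jump setT x (fun y => y = c)).
have mt u : event measurable (fun w => in_tree (split w) u).
  elim: u => [|i u IH] /=; first exact: (event_const sigma_m).
  apply: (@event_ext _ measurable (fun w => in_tree (split w) u /\ (i -> split w u))).
    by move=> w; split=> [[-> h]|/andP[-> /implyP h]] //; exact/implyP.
  by apply: (event_and sigma_m) => //; apply: (event_imply sigma_m) => //;
      exact: (event_const sigma_m).
have mp u x : event measurable (fun w => position (jump w) u = x).
  elim: u x => [|i u IH] x /=; first exact: (event_const sigma_m).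
  apply: (@event_ext _ measurable (fun w => exists y : 'rV[int]_d, position (jump w) u = y /\
      jump w (i :: u) = x - y)).
    move=> w; split=> [[y [-> ->]]|<-]; first by rewrite addrC subrK.
    by exists (position (jump w) u); split=> //; rewrite [_ + jump _ _]addrC addrK.
  by apply: (event_exists sigma_m) => y; exact: (event_and sigma_m).
apply: (@event_ext _ measurable (fun w => exists o : option 'I_kappa, D o /\
   observed_color (xi w) (split w) (jump w) v = o)).
  move=> w; split=> [[oc [ho E]]|h]; first by rewrite /= E.
  by exists (observed_color (xi w) (split w) (jump w) v).
apply: (event_exists sigma_m) => o; apply: (event_and sigma_m); first exact: (event_const sigma_m).
apply: (@event_ext _ measurable (fun w => (in_tree (split w) v ->
    exists x : 'rV[int]_d, position (jump w) v = x /\ exists c, xi w x = c /\ Some c = o) /\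
  (~ in_tree (split w) v -> None = o))).
  move=> w; rewrite /observed_color; case: ifP => tv; split=> [[h h']|<-].
  - by have [x [-> [c [-> ->]]]] := h isT.
  - by split=> // _; do 2 eexists; first exact: erefl; eexists; split; first exact: erefl.
  - by rewrite h'.
  - by split.
apply: (event_and sigma_m); apply: (event_imply sigma_m) => //.
- apply: (event_exists sigma_m) => x; apply: (event_and sigma_m) => //.
  apply: (event_exists sigma_m) => c; apply: (event_and sigma_m) => //;
      exact: (event_const sigma_m).
- exact: (event_not sigma_m).
exact: (event_const sigma_m).
Qed.

Lemma event_equiv (L : colored_tree kappa -> scenery d kappa) :
  (forall x (Q : 'I_kappa -> Prop), event (@colored_tree_sigma kappa) (fun t => Q (L t x))) ->
  event measurable (fun w => scenery_equiv R (L (observation (xi w) (split w) (jump w))) (xi w)).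
Proof.
move=> mL; apply: (event_ext (fun w => iff_sym (scenery_equivE R _ _))).
apply: (event_exists sigma_m) => A; apply: (event_and sigma_m); first exact: (event_const sigma_m).
apply: (event_forall sigma_m) => x.
apply: (@event_ext _ measurable (fun w => exists c,
   L (observation (xi w) (split w) (jump w)) (affine A x) = c /\ xi w x = c)).
  by move=> w; split=> [[c [-> ->]]|->] //; exists (xi w x).
apply: (event_exists sigma_m) => c; apply: (event_and sigma_m).
  exact: (event_observation (mL (affine A x) (fun c' => c' = c))).
by apply: (mevent model (J := setT));
    exact: (@event_xi _ _ _ _ xi split jump setT x (fun y => y = c)).
Qed.

End AlmostSure.

(** * Deterministic reconstruction from good scales *)

Section Reconstruction.
Variables (R : realType) (d kappa K C : nat).
Hypotheses (d0 : (0 < d)%N) (C0 : (0 < C)%N).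

Let T (k : nat) := (K.+2 ^ k)%N.
Let m (k : nat) := (C * k)%N.
Let N (k : nat) := (m k + m k)%N.

Definition far (k : nat) : nat :=
  (\max_(x <- cube d (N k).+2) @choice.pickle 'rV[int]_d x).+1.

(** The dictionary is coded by a finite word to keep the existential countable. Of the radius
    [(N k).+2] rigidity keeps [(N k).+1], enough to contain the straight segments that tie scale [k]
    to the next. *)
Definition consistent (k : nat) (chi : colored_tree kappa) (eta : 'rV[int]_d -> 'I_kappa) :=
  exists D : seq (seq 'I_kappa * seq 'I_kappa),
    valid (seen chi) (N k) (N k).+2 (T k.+1) (T k.+2) (T k.+3) (pattern ([::], [::]) D) eta.

Lemma far_pickle k (x : 'rV[int]_d) : (nrm x <= (N k).+2)%N -> (choice.pickle x < far k)%N.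
Proof. by move=> /mem_cube xc; rewrite ltnS; exact: leq_bigmax_seq. Qed.

Lemma consistent_local k chi f g :
  (forall x : 'rV[int]_d, (choice.pickle x < far k)%N -> f x = g x) ->
  consistent k chi f -> consistent k chi g.
Proof.
move=> fg [D vD]; exists D; apply: valid_local vD => // x xr.
by apply: fg; exact: far_pickle.
Qed.

Lemma event_consistent k f :
  event (@colored_tree_sigma kappa) (fun chi => consistent k chi f).
Proof.
have sigma_tree : sigma_algebra setT (@colored_tree_sigma kappa) by exact: sigma_algebra_coordinate.
apply: (event_exists sigma_tree) => D; apply: (event_valid sigma_tree) => t a b c.
exact: event_seen.
Qed.

Variables (xi : scenery d kappa) (split : particle -> bool) (jump : particle -> site d).
Hypothesis nearest : forall v, exists e, jump v = vec e.
Notation chi := (observation xi split jump).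
Variable k0 : nat.
Hypothesis k0_pos : (0 < k0)%N.
Hypothesis room : forall k, (k0 <= k)%N -> ((m k + m k).+2 <= T k)%N.
Hypothesis hit_all : forall k, (k0 <= k)%N ->
  forall (y : 'rV[int]_d) p q1 q2, (nrm y <= T k)%N ->
    size p = (N k).+1 -> size q1 = (N k).+1 -> size q2 = (N k).+1 ->
    exists2 n, (n <= K * T k)%N & hits split jump (pos y p) (star p q1 q2) n [::] 0.
Hypothesis loc : forall k, (k0 <= k)%N -> localizes xi (T k.+3).+1 (m k).

Let T_mono k : (T k <= T k.+1)%N.
Proof. by rewrite /T expnS leq_pmull. Qed.

Let m_pos k : (k0 <= k)%N -> (0 < m k)%N.
Proof. by move=> h; rewrite muln_gt0 C0 (leq_trans k0_pos). Qed.

Let N_mono k j : (k <= j)%N -> (N k <= N j)%N.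
Proof. by move=> kj; rewrite leq_add // leq_mul. Qed.

Let seen_complete k j : (k0 <= k)%N -> (k <= j)%N -> complete (seen chi) xi (N k).+1 (T j) (T j.+1).
Proof.
move=> hk kj y p1 p2 p3 yT s1 s2 s3; have hj := leq_trans hk kj.
have NN : ((N k).+1 <= (N j).+1)%N by rewrite ltnS N_mono.
(* Here [T j.+1] is [K.+2 * T j]: the multiple [K] covers the hitting time, and the two additional
   units cover the legs of the star before and after the fork. *)
have time : (K * T j + (N j).+1 + (N j).+1 <= T j.+1)%N.
  have := room hj; rewrite [T j.+1]expnS -/(T j) !mulSn -/(N j).
  by move: (N j) (T j) => u v; move: (K * v)%N => w; lia.
have all := seen_observation_complete xi d0 (isT : 0 < (N j).+1)%N (leqnn (T j)) (hit_all hj) time.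
by apply: all => //; exact: leq_trans NN.
Qed.

Lemma consistent_truth k : (k0 <= k)%N -> consistent k chi xi.
Proof.
move=> hk; pose e0 : dir d := (Ordinal d0, true).
have [D DE] := patternP (([::], [::]) : label 'I_kappa) (straight_label xi (m k) e0) (far k).
exists D; apply: (valid_local (D := straight_label xi (m k) e0) (eta := xi)) => //.
  by move=> x xr; rewrite DE //; exact: far_pickle.
apply: (valid_truth e0 (seen_observation_sound nearest) (t0 := T k)); try exact: T_mono.
- exact: seen_complete.
- by apply: seen_complete; rewrite // leqW.
- exact: loc.
exact: room.
Qed.

Lemma consistent_sound eta k1 :
  (forall k, (k1 <= k)%N -> consistent k chi eta) -> scenery_equiv R eta xi.
Proof.
move=> h; pose k2 := maxn k0 k1; pose e0 : dir d := (Ordinal d0, true).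
have copy k : exists A : 'rV[int]_d * 'M[int]_d, (k2 <= k)%N ->
   [/\ A.2 *m A.2^T = 1%:M, (nrm (affine A 0) <= T k.+1)%N &
     forall x, (nrm x <= (N k).+1)%N -> eta x = xi (affine A x)].
  have [hk|] := leqP k2 k; last by exists (0, 0).
  move: hk; rewrite geq_max => /andP[hk0 hk1]; have [D vD] := h k hk1.
  have [||||A [MA A0] EA] := valid_sound e0 (seen_observation_sound nearest) _ _ _ _ vD.
  - by apply: seen_complete; rewrite // leqW.
  - exact: loc.
  - exact: T_mono.
  - exact: T_mono.
  by exists A.
have [A hA] := choice copy.
(* The same [eta] is placed at scales [k] and [k.+1], so the two placements carry the same colors on
   the ball of radius [N k]. *)
have A_const k : (k2 <= k)%N -> A k = A k2.
  elim: k => [|k IH]; first by rewrite leqn0 => /eqP ->.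
  rewrite leq_eqVlt => /orP[/eqP -> //|]; rewrite ltnS => hk; rewrite -IH //.
  have [M1 B1 E1] := hA k hk; have [M2 B2 E2] := hA k.+1 (leqW hk).
  have hk0 : (k0 <= k)%N by apply: leq_trans hk; exact: leq_maxl.
  apply: (affine_uniq d0 (m_pos hk0) M2 M1 _ _ (loc hk0)).
  - by apply: leqW; apply: leq_trans B2 _; exact: T_mono.
  - by apply: leqW; apply: leq_trans B1 _; apply: leq_trans (T_mono _); exact: T_mono.
  move=> x xm; rewrite -E1 ?leqW // -E2 // leqW //.
  by apply: leq_trans xm _; exact: (N_mono (leqnSn k)).
have [M2 _ _] := hA k2 (leqnn _).
apply: scenery_equiv_sym; apply/scenery_equivE; exists (A k2); split=> // x.
(* Since [k <= N k], this scale covers [x]. *)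
pose k := maxn k2 (nrm x).
have kk2 : (k2 <= k)%N by exact: leq_maxl.
have [_ _ E] := hA k kk2; rewrite -(A_const k kk2) -E //.
apply: leqW; apply: leq_trans (leq_maxr k2 _) _; rewrite -/k.
by apply: leq_trans (leq_addr _ _); rewrite leq_pmull.
Qed.

End Reconstruction.

Theorem theorem2p1 (R : realType) (d kappa : nat) (b : R)
    (hd : (1 <= d)%N) (hb0 : 0 < b) (hb1 : b < 1)
    (hkappa4 : (4 <= kappa)%N) (hkappa : (2 * d + 1 <= kappa)%N) :
  exists Lambda : colored_tree kappa -> scenery d kappa,
    measurable_reconstruction Lambda /\
    forall (disp : measure_display) (Omega : measurableType disp)
      (P : probability Omega R) (xi : Omega -> scenery d kappa)
      (split : Omega -> particle -> bool) (jump : Omega -> particle -> site d),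
      scenery_and_BRW P b xi split jump ->
      P [set w | scenery_equiv R
                   (Lambda (observation (xi w) (split w) (jump w))) (xi w)]
      = 1%E.
Proof.
have kd : (2 * d < kappa)%N by rewrite -addn1.
have sigma_tree : sigma_algebra setT (@colored_tree_sigma kappa) by exact: sigma_algebra_coordinate.
have [K hK] := unseen_le hd hb0 (ltW hb1).
pose rho := 1 - b * success R d.
have s0 : 0 < success R d by rewrite exprn_gt0 // invr_gt0.
have s1 : success R d <= 1 by rewrite exprn_ile1 ?invr_ge0 // invf_le1 ?ler1n.
have rho0 : 0 <= rho by rewrite subr_ge0 mulr_ile1 // ltW.
have rho1 : rho < 1 by rewrite gtrBl mulr_gt0.
have [C [k1 [C0 hk1]]] := scales hd kd (isT : (1 < K.+2)%N) rho0 rho1.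
have c0 : 'I_kappa by exists 0%N; exact: leq_trans hkappa4.
have [L [mL hL]] := selection c0 sigma_tree (@event_consistent d kappa K C)
  (@consistent_local d kappa K C).
exists L; split.
  apply: sigma_algebra_preimage_sub => // _ [z _ [D _ <-]]; rewrite setTI.
  exact: mL z D.
move=> disp Omega P xi split jump model.
pose sm := sigma_algebra_measurable Omega.
pose m k := (C * k)%N; pose N k := (m k + m k)%N; pose T k := (K.+2 ^ k)%N.
have exU k : exists B : Omega -> Prop, [/\ event measurable B,
    (k1 <= k)%N -> pr P B <= 2 / (2 ^ k.+1)%:R
  & (k1 <= k)%N -> forall w, ~ B w -> forall (y : 'rV[int]_d) p q1 q2, (nrm y <= T k)%N ->
      size p = (N k).+1 -> size q1 = (N k).+1 -> size q2 = (N k).+1 ->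
      exists2 n, (n <= K * T k)%N & hits (split w) (jump w) (pos y p) (star p q1 q2) n [::] 0].
  have [hk|] := leqP k1 k; last by exists (fun=> False); split=> //; exact: (event_const sm).
  have [room bound _] := hk1 k hk.
  have [B [mB pB hB]] := hK _ _ _ _ _ _ _ model (T k) (N k).+1 isT (ltnW room).
  by exists B; split=> // _; exact: le_trans pB bound.
have [U hU] := choice exU.
have exV k : exists B : Omega -> Prop, [/\ event measurable B,
    (k1 <= k)%N -> pr P B <= 2 / (2 ^ k.+1)%:R
  & forall w, ~ B w -> localizes (xi w) (T k.+3).+1 (m k)].
  have [B [mB pB hB]] := not_localizes_le model (T k.+3).+1 (m k).
  exists B; split=> // hk; apply: le_trans pB _.
  by have [_ _] := hk1 k hk.
have [V hV] := choice exV.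
pose B k w := U k w \/ V k w.
have mB k : event measurable (B k).
  by apply: (event_or sm); [case: (hU k)|case: (hV k)].
have pB k : (k1 <= k)%N -> pr P (B k) <= 4 / (2 ^ k.+1)%:R.
  move=> hk; have [mU /(_ hk) pU _] := hU k; have [mV /(_ hk) pV _] := hV k.
  apply: le_trans (pr_or_le P mU mV) _; apply: le_trans (lerD pU pV) _.
  by rewrite -mulrDl -natrD.
pose E w := scenery_equiv R (L (observation (xi w) (split w) (jump w))) (xi w).
have mE : event measurable E by exact: (event_equiv model mL).
suff /measure_negligible nE0 : P.-negligible [set w | ~ E w].
  have : pr P (fun w => ~ E w) = 0 by rewrite /pr nE0 //; exact: (event_not sm mE).
  by rewrite pr_not // => /eqP; rewrite subr_eq0 => /eqP E1; rewrite [LHS](prE P mE) -E1.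
(* Outside one null set all large scales are good and all jumps are unit steps; the rest is
   deterministic. *)
have neg := negligibleU (pr_borel_cantelli mB pB) (negligible_not_nearest model hd).
apply: negligibleS neg => w nE /=; apply: contrapT => /not_orP[good /contrapT near].
apply: nE.
move/existsNP: good => [j hj].
(* The successor makes all word lengths [m k] positive. *)
pose k0 := (maxn j k1).+1.
have notB k : (k0 <= k)%N -> (k1 <= k)%N /\ ~ B k w.
  move=> hk; have jk : (j <= k)%N by apply: leq_trans (ltnW hk); exact: leq_maxl.
  split; first by apply: leq_trans (ltnW hk); exact: leq_maxr.
  by move=> Bk; apply: hj; exists k.
have room k : (k0 <= k)%N -> ((m k + m k).+2 <= T k)%N.
  by move=> /notB[/hk1[]].
have hits_all k : (k0 <= k)%N -> forall (y : 'rV[int]_d) p q1 q2, (nrm y <= T k)%N ->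
    size p = (N k).+1 -> size q1 = (N k).+1 -> size q2 = (N k).+1 ->
    exists2 n, (n <= K * T k)%N & hits (split w) (jump w) (pos y p) (star p q1 q2) n [::] 0.
  move=> /notB[hk nB]; have [_ _ /(_ hk w)] := hU k; apply.
  by move=> Uk; apply: nB; left.
have loc k : (k0 <= k)%N -> localizes (xi w) (T k.+3).+1 (m k).
  move=> /notB[hk nB]; have [_ _ /(_ w)] := hV k; apply.
  by move=> Vk; apply: nB; right.
have [|k2 hk2] := hL (observation (xi w) (split w) (jump w)).
  by exists (xi w), k0 => k hk; exact: (consistent_truth hd C0 near (isT : (0 < k0)%N) room
      hits_all loc hk).
exact: (consistent_sound R hd C0 near (isT : (0 < k0)%N) room hits_all loc hk2).
Qed.
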